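(* Let $\theta$ be a non-constant inner function and let $a,b\in L^\infty(\mathbb{T})$. For a bounded linear operator $X$ on $L^2(\mathbb{T})$, the following are equivalent: (1) there exists $\rho\in L^\infty(\mathbb{T})$ such that $X=M_{\rho+a+b}P_{\theta H^2}+M_{\rho+b}P_{\mathcal{K}_\theta}+M_\rho P_{-}$; (2) $[X,M_z]=a\theta\otimes\bar z\theta+b\otimes\bar z$. Equivalently, there exist $\varphi,\psi,\chi\in L^\infty(\mathbb{T})$ with $a=\varphi-\psi$, $b=\psi-\chi$ and $X=M_\varphi P_{\theta H^2}+M_\psi P_{\mathcal{K}_\theta}+M_\chi P_{-}$ if and only if $[X,M_z]=a\theta\otimes\bar z\theta+b\otimes\bar z$ (that is, $[X,M_z]=(\varphi-\psi)\theta\otimes\bar z\theta+(\psi-\chi)\otimes\bar z$).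
   Context: $\mathbb{T}$ is the unit circle with normalized Lebesgue measure; $H^2\subset L^2(\mathbb{T})$ is the Hardy space (functions with vanishing negative Fourier coefficients), and $H^2_-=L^2(\mathbb{T})\ominus H^2$. An inner function $\theta$ is a bounded analytic function on the unit disk with $|\theta|=1$ a.e. on $\mathbb{T}$. The model space is $\mathcal{K}_\theta=H^2\ominus\theta H^2$, so $L^2(\mathbb{T})=\theta H^2\oplus\mathcal{K}_\theta\oplus H^2_-$; $P_{\theta H^2}$, $P_{\mathcal{K}_\theta}$, $P_-$ denote the orthogonal projections of $L^2(\mathbb{T})$ onto the three summands, viewed as operators on $L^2(\mathbb{T})$. For $\varphi\in L^\infty(\mathbb{T})$, $M_\varphi f=\varphi f$ on $L^2(\mathbb{T})$; $M_z$ is multiplication by the coordinate function $z$. $[A,B]=AB-BA$. $(p\otimes q)f=\langle f,q\rangle p$ (inner product linear in the first variable). *)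

(* Defs.v *)
From HB Require Import structures.
From mathcomp Require Import all_boot all_order all_algebra.
From mathcomp Require Import all_classical all_reals all_analysis.
From mathcomp Require Import generic_quotient ring_quotient.
From mathcomp Require Import measurable_realfun ess_sup_inf.
From mathcomp Require Import complex.

Set Implicit Arguments.
Unset Strict Implicit.
Unset Printing Implicit Defensive.
Import Order.TTheory GRing.Theory Num.Theory.
Import numFieldNormedType.Exports.
Local Open Scope classical_set_scope.
Local Open Scope ring_scope.
Local Open Scope complex_scope.
Local Open Scope quotient_scope.

Section CircleMeasure.
Variable R : realType.

(* The unit circle is parametrised by [0, 1[ through t |-> exp(2 pi i t);
   functions on the circle are functions of t, and what they do outside
   [0, 1[ is negligible for this measure. *)
Definition circle_measure : set (measurableTypeR R) -> \bar R :=
  mrestr (@lebesgue_measure R) (measurable_itv `[(0 : R), 1[).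

HB.instance Definition _ := Measure.on circle_measure.

Lemma circle_measureT : circle_measure setT = 1%E.
Proof.
rewrite /circle_measure /mrestr setTI lebesgue_measure_itv/= lte_fin ltr01.
by rewrite oppr0 adde0.
Qed.

HB.instance Definition _ :=
  Measure_isProbability.Build _ _ _ circle_measure circle_measureT.

End CircleMeasure.

Section ComplexLp.
Context d (T : measurableType d) (R : realType).
Variables (mu : {measure set T -> \bar R}) (p : \bar R) (p1 : (1 <= p)%E).
Implicit Types f g : T -> R[i].
Local Notation normc := (@Normc.normc R).

Definition cmeasurable f :=
  measurable_fun setT (fun t => complex.Re (f t)) /\
  measurable_fun setT (fun t => complex.Im (f t)).

(* The proof of 1 <= p is a dummy argument: it lets the Z-module structure below
   be inferred from the predicate alone. *)
Definition cLfun (_ : (1 <= p)%E) : {pred T -> R[i]} := mem [set f |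
  cmeasurable f /\ (fun t => normc (f t)) \in Lfun mu p].

Lemma normc_def2 (z : R[i]) :
  normc z = Num.sqrt (complex.Re z ^+ 2 + complex.Im z ^+ 2).
Proof. by case: z. Qed.

Lemma normc_ge0 (z : R[i]) : 0 <= normc z.
Proof. by rewrite normc_def2 sqrtr_ge0. Qed.

Lemma cmeasurable_normc f :
  cmeasurable f -> measurable_fun setT (fun t => normc (f t)).
Proof.
move=> [mr mi]; under eq_fun do rewrite normc_def2.
apply: measurableT_comp.
  by apply: continuous_measurable_fun; exact: sqrt_continuous.
by apply: measurable_funD; apply: measurable_funX.
Qed.

Lemma cmeasurableN f : cmeasurable f -> cmeasurable (- f).
Proof.
move=> [mr mi]; split.
  rewrite (_ : (fun t => _) = \- (fun t => complex.Re (f t))); last first.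
    by apply/funext => t; rewrite opprfctE/=; case: (f t).
  exact: measurable_funN.
rewrite (_ : (fun t => _) = \- (fun t => complex.Im (f t))).
  exact: measurable_funN.
by apply/funext => t; rewrite opprfctE/=; case: (f t).
Qed.

Lemma cmeasurableD f g : cmeasurable f -> cmeasurable g -> cmeasurable (f + g).
Proof.
move=> [fr fi] [gr gi]; split.
  rewrite (_ : (fun t => _) =
    (fun t => complex.Re (f t)) \+ (fun t => complex.Re (g t))).
    exact: measurable_funD.
  by apply/funext => t; rewrite addrfctE/=; case: (f t); case: (g t).
rewrite (_ : (fun t => _) =
  (fun t => complex.Im (f t)) \+ (fun t => complex.Im (g t))).
  exact: measurable_funD.
by apply/funext => t; rewrite addrfctE/=; case: (f t); case: (g t).
Qed.

Lemma cmeasurableM f g : cmeasurable f -> cmeasurable g -> cmeasurable (f \* g).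
Proof.
move=> [fr fi] [gr gi]; split.
  rewrite (_ : (fun t => _) =
    ((fun t => complex.Re (f t)) \* (fun t => complex.Re (g t))) \-
    ((fun t => complex.Im (f t)) \* (fun t => complex.Im (g t)))).
    by apply: measurable_funB; apply: measurable_funM.
  by apply/funext => t /=; case: (f t); case: (g t).
rewrite (_ : (fun t => _) =
  ((fun t => complex.Re (f t)) \* (fun t => complex.Im (g t))) \+
  ((fun t => complex.Im (f t)) \* (fun t => complex.Re (g t)))).
  by apply: measurable_funD; apply: measurable_funM.
by apply/funext => t /=; case: (f t); case: (g t).
Qed.

Lemma cmeasurable_cst (c : R[i]) : cmeasurable (cst c).
Proof. by split; exact: measurable_cst. Qed.

Lemma Lfun_dominated (h k : T -> R) : measurable_fun setT h ->
  (\forall t \ae mu, `|h t| <= k t) -> k \in Lfun mu p -> h \in Lfun mu p.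
Proof.
move=> mh hk /andP[mk /[!inE]/= kp].
rewrite inE in mk.
have hk' : \forall t \ae mu, `|h t| <= `|k t|.
  by apply: filterS hk => t /le_trans; apply; exact: ler_norm.
apply/andP; split; rewrite in_setE//=.
apply: le_lt_trans kp; rewrite /finite_norm unlock.
case: p p1 => [r r1|_|//].
  have r0 : 0 <= r by rewrite (le_trans ler01).
  have mr (u : T -> R) : measurable_fun setT u ->
      measurable_fun setT (fun t => `|(EFin \o u) t| `^ r)%E.
    move=> mu'; apply: (measurableT_comp (measurable_poweR _)).
    by apply: measurableT_comp => //; exact/measurable_EFinP.
  apply: gt0_ler_poweR; rewrite ?invr_ge0//.
  - by rewrite in_itv/= leey andbT integral_ge0// => x _; rewrite poweR_ge0.
  - by rewrite in_itv/= leey andbT integral_ge0// => x _; rewrite poweR_ge0.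
  apply: ae_ge0_le_integral => //.
  - by move=> x _; rewrite poweR_ge0.
  - exact: mr.
  - by move=> x _; rewrite poweR_ge0.
  - exact: mr.
  apply: filterS hk' => t ht _.
  by apply: gt0_ler_poweR; rewrite ?in_itv/= ?leey ?lee_fin ?normr_ge0//.
case: ifPn => // _; apply: le_ess_sup; apply: filterS hk' => t ht.
by rewrite /= lee_fin.
Qed.

Lemma cLfunP f :
  f \in cLfun p1 -> cmeasurable f /\ (fun t => normc (f t)) \in Lfun mu p.
Proof. by move=> /[!in_setE]. Qed.

Lemma cLfun_dominated f (k : T -> R) : cmeasurable f ->
  (\forall t \ae mu, normc (f t) <= k t) -> k \in Lfun mu p -> f \in cLfun p1.
Proof.
move=> mf fk kp; rewrite in_setE; split=> //.
apply: (Lfun_dominated (cmeasurable_normc mf) _ kp).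
by apply: filterS fk => t; rewrite ger0_norm ?normc_ge0.
Qed.

Lemma cLfun_zmod_closed : zmod_closed (cLfun p1).
Proof.
split.
  rewrite in_setE; split; first exact: (cmeasurable_cst 0).
  rewrite (_ : (fun t => _) = cst 0); first exact: (@rpred0 _ (Lfun mu p)).
  by apply/funext => t /=; rewrite expr0n/= addr0 sqrtr0.
move=> f g /cLfunP[mf fp] /cLfunP[mg gp].
apply: (cLfun_dominated (cmeasurableD mf (cmeasurableN mg))
  _ (rpredD fp gp)) => //.
apply/aeW => t /=; rewrite addrfctE opprfctE -[X in _ <= _ + X]normcN.
exact: (@le_normcD R).
Qed.

HB.instance Definition _ := GRing.isZmodClosed.Build _ (cLfun p1)
  cLfun_zmod_closed.

Lemma cLfun_scale (c : R[i]) f :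
  f \in cLfun p1 -> (fun t => c * f t) \in cLfun p1.
Proof.
move=> /cLfunP[mf fp].
have kp : normc c *: (fun t => normc (f t) : R^o) \in Lfun mu p.
  by apply: rpredZ.
apply: (cLfun_dominated (cmeasurableM (cmeasurable_cst c) mf) _ kp).
by apply/aeW => t /=; rewrite Normc.normcM.
Qed.

Record cLfunType := CLfun {
  cLfun_val :> T -> R[i];
  _ : cLfun_val \in cLfun p1 }.

HB.instance Definition _ := [isSub for cLfun_val].
HB.instance Definition _ := [Choice of cLfunType by <:].
HB.instance Definition _ := [SubChoice_isSubZmodule of cLfunType by <:].

(* L^p is the quotient of cLfunType by the functions that vanish a.e. *)
Definition cnull : {pred cLfunType} := mem [set f : cLfunType |
  \forall t \ae mu, f t = 0].

Lemma cnull_zmod_closed : zmod_closed cnull.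
Proof.
split=> [|f g]; rewrite !in_setE; first exact/aeW.
move=> f0 g0; apply: filterS2 f0 g0 => t ft gt.
by rewrite /= addrfctE opprfctE ft gt subrr.
Qed.

HB.instance Definition _ := GRing.isZmodClosed.Build _ cnull cnull_zmod_closed.

Definition cLp : Type := Quotient.quot cnull.
HB.instance Definition _ := Choice.on cLp.
HB.instance Definition _ := EqQuotient.on cLp.
HB.instance Definition _ := GRing.Zmodule.on cLp.

(* a representative, determined up to a.e. equality *)
Definition cLp_fun (f : cLp) : T -> R[i] := repr f.

Definition cLp_class f (fp : f \in cLfun p1) : cLp := \pi_cLp (CLfun fp).

Lemma cLp_classP f g (fp : f \in cLfun p1) (gp : g \in cLfun p1) :
  cLp_class fp = cLp_class gp <-> (\forall t \ae mu, f t = g t).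
Proof.
rewrite /cLp_class; split.
  move/eqP; rewrite -Quotient.idealrBE in_setE.
  apply: filterS => t /=; rewrite addrfctE opprfctE => /eqP.
  by rewrite subr_eq0 => /eqP.
move=> fg; apply/eqP; rewrite -Quotient.idealrBE in_setE.
by apply: filterS fg => t /= E; rewrite addrfctE opprfctE E subrr.
Qed.

Lemma cLp_fun_Lfun (f : cLp) : cLp_fun f \in cLfun p1.
Proof. exact: valP. Qed.

Lemma cLp_funK (f : cLp) (fp : cLp_fun f \in cLfun p1) : cLp_class fp = f.
Proof.
rewrite -[RHS]reprK /cLp_class; congr (\pi_cLp _); exact: val_inj.
Qed.

Lemma cLp_class_fun f (fp : f \in cLfun p1) :
  \forall t \ae mu, cLp_fun (cLp_class fp) t = f t.
Proof. by apply/(cLp_classP (cLp_fun_Lfun _)); exact: cLp_funK. Qed.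

Lemma cLp_ext (f g : cLp) :
  (\forall t \ae mu, cLp_fun f t = cLp_fun g t) -> f = g.
Proof.
move=> /(cLp_classP (cLp_fun_Lfun f) (cLp_fun_Lfun g)).
by rewrite !cLp_funK.
Qed.

Lemma cLp_funD (f g : cLp) :
  \forall t \ae mu, cLp_fun (f + g) t = cLp_fun f t + cLp_fun g t.
Proof.
have fgp : cLp_fun f \+ cLp_fun g \in cLfun p1.
  exact: (rpredD (cLp_fun_Lfun f) (cLp_fun_Lfun g)).
suff <- : cLp_class fgp = f + g by exact: cLp_class_fun.
rewrite -[in RHS](reprK f) -[in RHS](reprK g) -raddfD.
congr (\pi_cLp _); exact: val_inj.
Qed.

Definition cLp_scale (c : R[i]) (f : cLp) : cLp :=
  cLp_class (cLfun_scale c (cLp_fun_Lfun f)).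

Lemma cLp_scaleE (c : R[i]) (f : cLp) :
  \forall t \ae mu, cLp_fun (cLp_scale c f) t = c * cLp_fun f t.
Proof. exact: cLp_class_fun. Qed.

Lemma cLp_scaleA a b (f : cLp) :
  cLp_scale a (cLp_scale b f) = cLp_scale (a * b) f.
Proof.
apply: cLp_ext; apply: filterS3 (cLp_scaleE a (cLp_scale b f))
  (cLp_scaleE b f) (cLp_scaleE (a * b) f) => t -> -> ->.
by rewrite mulrA.
Qed.

Lemma cLp_scale1 : left_id 1 cLp_scale.
Proof.
move=> f; apply: cLp_ext.
by apply: filterS (cLp_scaleE 1 f) => t ->; rewrite mul1r.
Qed.

Lemma cLp_scaleDr : right_distributive cLp_scale +%R.
Proof.
move=> c f g; apply: cLp_ext.
apply: filterS3 (cLp_scaleE c (f + g)) (cLp_funD f g)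
  (filterI (cLp_funD (cLp_scale c f) (cLp_scale c g))
    (filterI (cLp_scaleE c f) (cLp_scaleE c g))) => t -> -> [-> [-> ->]].
by rewrite mulrDr.
Qed.

Lemma cLp_scaleDl (f : cLp) : {morph cLp_scale^~ f : a b / a + b}.
Proof.
move=> a b; apply: cLp_ext.
apply: filterS3 (cLp_scaleE (a + b) f)
  (cLp_funD (cLp_scale a f) (cLp_scale b f))
  (filterI (cLp_scaleE a f) (cLp_scaleE b f)) => t -> -> [-> ->].
by rewrite mulrDl.
Qed.

HB.instance Definition _ := GRing.Zmodule_isLmodule.Build R[i] cLp
  cLp_scaleA cLp_scale1 cLp_scaleDr cLp_scaleDl.

End ComplexLp.

Section ComplexLpMultiplication.
Context d (T : measurableType d) (R : realType).
Variables (mu : {measure set T -> \bar R}) (p : \bar R) (p1 : (1 <= p)%E).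

Lemma cLfun_oo_bounded (phi : T -> R[i]) : phi \in cLfun mu (leey 1) ->
  exists K : R, \forall t \ae mu, Normc.normc (phi t) <= K.
Proof.
move=> /cLfunP[_ /andP[_]]; rewrite in_setE/= /finite_norm unlock.
case: ifPn => [_|mu0 _].
  set F := (X in ess_sup _ X); move=> Foo.
  have := ess_sup_ge mu F.
  case: (ess_sup mu F) Foo => [r _|//|_] FK; [exists r|exists 0];
    apply: filterS FK => t; rewrite /F/= ?lee_fin ?leeNy_eq//.
  by apply: le_trans; exact: ler_norm.
exists 0; have {}mu0 : mu setT = 0%E.
  by apply/eqP; rewrite eq_le measure_ge0 andbT leNgt.
by exists setT; split.
Qed.

Lemma cLfunM (phi f : T -> R[i]) :
  phi \in cLfun mu (leey 1) -> f \in cLfun mu p1 -> phi \* f \in cLfun mu p1.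
Proof.
move=> phioo /cLfunP[mf fp]; have [mphi _] := cLfunP phioo.
have [K phiK] := cLfun_oo_bounded phioo.
have kp : K *: (fun t => Normc.normc (f t) : R^o) \in Lfun mu p.
  by apply: rpredZ.
apply: (cLfun_dominated p1 (cmeasurableM mphi mf) _ kp).
apply: filterS phiK => t tK.
by rewrite Normc.normcM; apply: ler_wpM2r => //; exact: normc_ge0.
Qed.

Definition cLp_mul (phi : cLp mu (leey 1)) (f : cLp mu p1) : cLp mu p1 :=
  cLp_class (cLfunM (cLp_fun_Lfun phi) (cLp_fun_Lfun f)).

End ComplexLpMultiplication.

Section Circle.
Variable R : realType.
Local Notation mu := (@circle_measure R).

(* exp(2 pi i t), the coordinate function z *)
Definition circle_pt (t : R) : R[i] :=
  cos (2 * trigo.pi * t) +i* sin (2 * trigo.pi * t).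

Definition L2T : Type := @cLp _ _ R (@circle_measure R) 2%:E (lee1n 2).
HB.instance Definition _ := GRing.Lmodule.on L2T.

Definition LinfT : Type := @cLp _ _ R (@circle_measure R) +oo%E (leey 1).
HB.instance Definition _ := GRing.Lmodule.on LinfT.

Definition cintegral (h : R -> R[i]) : R[i] :=
  (\int[mu]_t complex.Re (h t)) +i* (\int[mu]_t complex.Im (h t)).

(* linear in the first variable *)
Definition inner (f g : L2T) : R[i] :=
  cintegral (fun t => cLp_fun f t * conjc (cLp_fun g t)).

Definition L2norm (f : L2T) : R := Num.sqrt (complex.Re (inner f f)).

Definition bounded_operator (X : L2T -> L2T) : Prop :=
  exists K : R, forall f, L2norm (X f) <= K * L2norm f.

Definition mulop (phi : LinfT) (f : L2T) : L2T := cLp_mul phi f.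

Lemma circle_pt_normc t : Normc.normc (circle_pt t) = 1.
Proof. by rewrite /= cos2Dsin2 sqrtr1. Qed.

Lemma circle_ptC_normc t : Normc.normc (conjc (circle_pt t)) = 1.
Proof. by rewrite /= sqrrN cos2Dsin2 sqrtr1. Qed.

Lemma Lfun_cst1 p : (1 <= p)%E ->
  (cst 1 : measurableTypeR R -> R) \in Lfun mu p.
Proof.
case: p => [r _|_|//]; first exact: Lfun_cst.
apply/andP; split; rewrite in_setE//=.
rewrite /finite_norm unlock; case: ifPn => // _.
apply: le_lt_trans (ltry 1); apply/ess_supP/aeW => t /=.
by rewrite normr1.
Qed.

Lemma circle_unimodular p (p1 : (1 <= p)%E) (f : R -> R[i]) :
  @cmeasurable _ (measurableTypeR R) _ f ->
  (forall t, Normc.normc (f t) = 1) -> f \in cLfun mu p1.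
Proof.
move=> mf f1; apply: (cLfun_dominated p1 mf _ (Lfun_cst1 p1)).
by apply/aeW => t; rewrite f1.
Qed.

Lemma circle_pt_cmeasurable : @cmeasurable _ (measurableTypeR R) _ circle_pt.
Proof.
have m2 : measurable_fun setT (fun t : R => 2 * trigo.pi * t).
  by apply: measurable_funM; [exact: measurable_cst|exact: measurable_id].
split; rewrite /circle_pt/=; apply: measurableT_comp m2;
  apply: continuous_measurable_fun.
  exact: continuous_cos.
exact: continuous_sin.
Qed.

Lemma circle_ptC_cmeasurable :
  @cmeasurable _ (measurableTypeR R) _ (fun t => conjc (circle_pt t)).
Proof.
by have [mr mi] := circle_pt_cmeasurable; split => //; exact: measurable_funN.
Qed.

Lemma cst1_Lfun p (p1 : (1 <= p)%E) : cst 1 \in cLfun mu p1.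
Proof.
apply: circle_unimodular => [|t]; first exact: cmeasurable_cst.
exact: Normc.normc1.
Qed.

Lemma circle_pt_Lfun p (p1 : (1 <= p)%E) : circle_pt \in cLfun mu p1.
Proof.
apply: circle_unimodular; first exact: circle_pt_cmeasurable.
exact: circle_pt_normc.
Qed.

Lemma circle_ptC_Lfun p (p1 : (1 <= p)%E) :
  (fun t => conjc (circle_pt t)) \in cLfun mu p1.
Proof.
apply: circle_unimodular; first exact: circle_ptC_cmeasurable.
exact: circle_ptC_normc.
Qed.

Definition one_T : L2T := cLp_class (cst1_Lfun (lee1n 2)).

Definition z_T : LinfT := cLp_class (circle_pt_Lfun (leey 1)).

Definition zbar_T : LinfT := cLp_class (circle_ptC_Lfun (leey 1)).

(* the inclusion of L^oo in L^2 *)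
Definition toL2 (phi : LinfT) : L2T := mulop phi one_T.

Definition fourier_coef (f : L2T) (n : int) : R[i] :=
  cintegral (fun t => cLp_fun f t * circle_pt t ^ (- n)).

Definition H2 : set L2T :=
  [set f | forall n : int, n < 0 -> fourier_coef f n = 0].

Definition orthocomp (S : set L2T) : set L2T :=
  [set f | forall g, S g -> inner f g = 0].

Definition H2minus : set L2T := orthocomp H2.

Definition thetaH2 (theta : LinfT) : set L2T := mulop theta @` H2.

Definition model_space (theta : LinfT) : set L2T :=
  H2 `&` orthocomp (thetaH2 theta).

(* The orthogonal projection onto S: the g in S such that f - g is orthogonal to
   S. It is unique when S is a subspace, and exists when S is moreover closed;
   the value 0 is taken when there is none. *)
Definition orthoproj (S : set L2T) (f : L2T) : L2T :=
  xget 0 [set g | S g /\ orthocomp S (f - g)].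

Definition commutator (A B : L2T -> L2T) : L2T -> L2T :=
  fun f => A (B f) - B (A f).

Definition rank_one (p q : L2T) (f : L2T) : L2T := inner f q *: p.

Definition unit_disk : set R[i] := [set w | `|w| < 1].

(* F is the sum of a power series that converges in the whole disk. *)
Definition analytic_on_disk (F : R[i] -> R[i]) : Prop :=
  exists c : nat -> R[i], forall w, unit_disk w ->
    ([series c n * w ^+ n]_n : nat -> R[i]^o) @ \oo --> (F w : R[i]^o).

Definition bounded_on_disk (F : R[i] -> R[i]) : Prop :=
  exists K : R, forall w, unit_disk w -> Normc.normc (F w) <= K.

(* u is the boundary function of F: F has the radial limit u(z) at almost every
   point z of the circle. For bounded analytic F, such a u exists and is unique
   by Fatou's theorem. *)
Definition boundary_values (F : R[i] -> R[i]) (u : LinfT) : Prop :=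
  \forall t \ae mu,
    (F (r%:C * circle_pt t) : R[i]^o) @[r --> (1 : R)^'-]
      --> (cLp_fun u t : R[i]^o).

(* F is an inner function on the disk, and u is its boundary function, through
   which F acts on functions on the circle. *)
Definition inner_function (F : R[i] -> R[i]) (u : LinfT) : Prop :=
  [/\ analytic_on_disk F, bounded_on_disk F, boundary_values F u
    & \forall t \ae mu, `|cLp_fun u t| = 1].

Definition constant_on_disk (F : R[i] -> R[i]) : Prop :=
  exists c, forall w, unit_disk w -> F w = c.

End Circle.

(* Main.v *)
Require Import Defs.
From mathcomp Require Import all_boot all_order all_algebra.
From mathcomp Require Import all_classical all_reals all_analysis.
From mathcomp Require Import measurable_realfun ess_sup_inf complex.
From mathcomp Require Import ring lra.

(** Write P for the orthogonal projection on H^2 and T for the one on theta H^2.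
    As theta is unimodular, T is the conjugate of P by M_theta, and as theta H^2
    is contained in H^2, the projections on the model space and on H^2_- are
    P - T and 1 - P. The operator of condition (1) is therefore M_rho + A with
    A = M_a T + M_b P.

    Every h in H^2 is the sum of a constant and of an element of z H^2, and this
    makes [P, M_z] the rank-one operator 1 (x) zbar ([hardy_proj_z]); conjugating
    by M_theta, [T, M_z] is theta (x) zbar theta ([theta_proj_z]). Multiplication
    operators commute with M_z, so [A, M_z] is the right-hand side of (2)
    ([model_op_commutator]), and (1) implies (2). Conversely, (2) says that X - A
    commutes with M_z, and a bounded operator commuting with M_z is the
    multiplication by a bounded function ([commutant_multiplication]).

    This rests on three facts of analysis.
    - A subspace V of L^2 and a function f always admit a limit g of elements of V
      with f - g orthogonal to V ([L2_best_approximation], from the completeness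
      of L^2). It gives the projection on H^2 and, as only 0 is orthogonal to all
      trigonometric polynomials ([trig_total]), their density ([trig_dense]).
    - An operator Y commuting with M_z multiplies trigonometric polynomials by
      Y 1. Density and Fatou's lemma extend this to all of L^2, and testing on the
      set where Y 1 is large shows that Y 1 is bounded.
    - The boundary function of a bounded analytic function multiplies H^2 into
      itself ([H2_analytic_multiplier]), by dominated convergence along the
      dilations of that function and the partial sums of its power series. *)

Set Implicit Arguments.
Unset Strict Implicit.
Unset Printing Implicit Defensive.
Import Order.TTheory GRing.Theory Num.Theory.
Import numFieldNormedType.Exports.
Local Open Scope classical_set_scope.
Local Open Scope ring_scope.
Local Open Scope complex_scope.

(** * Integration of complex functions on the circle *)

Section ComplexIntegral.
Variable R : realType.
Local Notation mu := (@circle_measure R).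
Local Notation Rm := (measurableTypeR R).
Local Notation normc := (@Normc.normc R).
Local Notation cmeas := (@cmeasurable _ Rm R).
Local Notation Re := complex.Re.
Local Notation Im := complex.Im.

(** The almost-everywhere filter, seen on the type of real numbers rather than
    on its measurable copy, so that filter lemmas apply to predicates on R. *)
#[export] Instance ae_circle_filter :
  @Filter R (nbhs (almost_everywhere mu)) := ae_filter_ringOfSetsType mu.

(** The squared modulus, written as a polynomial in the two parts so that
    limits and measurability can be checked on each part separately. *)
Definition sqrc (z : R[i]) : R := Re z ^+ 2 + Im z ^+ 2.

Lemma sqrc_normc z : sqrc z = normc z ^+ 2.
Proof. by rewrite normc_def2 sqr_sqrtr// addr_ge0// sqr_ge0. Qed.

Lemma sqrc_ge0 z : 0 <= sqrc z.
Proof. by rewrite addr_ge0// sqr_ge0. Qed.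

Lemma sqrcM z w : sqrc (z * w) = sqrc z * sqrc w.
Proof. by rewrite !sqrc_normc Normc.normcM exprMn. Qed.

Lemma sqrc_eq0 z : sqrc z = 0 -> z = 0.
Proof. by rewrite sqrc_normc => /eqP; rewrite sqrf_eq0 => /eqP /Normc.eq0_normc. Qed.

Lemma mul_conjc (z : R[i]) : z * conjc z = (sqrc z)%:C.
Proof.
case: z => x y; rewrite /sqrc /=; apply/eqP; rewrite eq_complex /=.
by apply/andP; split; apply/eqP; ring.
Qed.

Lemma normc_Re z : `|Re z| <= normc z.
Proof.
rewrite normc_def2 -sqrtr_sqr ler_wsqrtr// lerDl; exact: sqr_ge0.
Qed.

Lemma normc_Im z : `|Im z| <= normc z.
Proof.
rewrite normc_def2 -sqrtr_sqr ler_wsqrtr// lerDr; exact: sqr_ge0.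
Qed.

Lemma normc_conj z : normc (conjc z) = normc z.
Proof. by case: z => x y /=; rewrite sqrrN. Qed.

Lemma cmeasurable_conj (f : R -> R[i]) : cmeas f -> cmeas (fun t => conjc (f t)).
Proof.
move=> [mr mi]; split.
  by rewrite (_ : (fun t => _) = (fun t => Re (f t)))//; apply/funext => t; case: (f t).
rewrite (_ : (fun t => _) = \- (fun t => Im (f t))).
  exact: measurable_funN.
by apply/funext => t /=; case: (f t).
Qed.

Lemma measurable_sqrc (f : R -> R[i]) : cmeas f ->
  measurable_fun [set: Rm] (fun t => sqrc (f t)).
Proof. by move=> [mr mi]; apply: measurable_funD; apply: measurable_funX. Qed.

Definition cintegrable (h : R -> R[i]) :=
  mu.-integrable setT (EFin \o (fun t => Re (h t))) /\
  mu.-integrable setT (EFin \o (fun t => Im (h t))).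

Lemma cintegrable_le (h : R -> R[i]) (k : R -> R) : cmeas h ->
  (forall t, normc (h t) <= k t) -> mu.-integrable setT (EFin \o k) ->
  cintegrable h.
Proof.
move=> [mr mi] hk ki; split.
  apply: (le_integrable measurableT _ _ ki); first exact/measurable_EFinP.
  move=> t _ /=; rewrite lee_fin (le_trans (normc_Re _))//.
  by rewrite (le_trans (hk t))// ler_norm.
apply: (le_integrable measurableT _ _ ki); first exact/measurable_EFinP.
move=> t _ /=; rewrite lee_fin (le_trans (normc_Im _))//.
by rewrite (le_trans (hk t))// ler_norm.
Qed.

Lemma cintegrableD (f g : R -> R[i]) :
  cintegrable f -> cintegrable g -> cintegrable (fun t => f t + g t).
Proof.
move=> [fr fi] [gr gi]; split.
  rewrite (_ : _ \o _ = (EFin \o (fun t => Re (f t))) \+ (EFin \o (fun t => Re (g t))))%E.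
    exact: integrableD.
  by apply/funext => t /=; case: (f t); case: (g t).
rewrite (_ : _ \o _ = (EFin \o (fun t => Im (f t))) \+ (EFin \o (fun t => Im (g t))))%E.
  exact: integrableD.
by apply/funext => t /=; case: (f t); case: (g t).
Qed.

Lemma cintegralD (f g : R -> R[i]) : cintegrable f -> cintegrable g ->
  cintegral (fun t => f t + g t) = cintegral f + cintegral g.
Proof.
move=> [fr fi] [gr gi]; rewrite /cintegral.
rewrite (_ : (fun t => Re _) = (fun t => Re (f t)) \+ (fun t => Re (g t))); last first.
  by apply/funext => t /=; case: (f t); case: (g t).
rewrite (_ : (fun t => Im _) = (fun t => Im (f t)) \+ (fun t => Im (g t))); last first.
  by apply/funext => t /=; case: (f t); case: (g t).
by rewrite !RintegralD.
Qed.

Lemma cReM (x y : R[i]) : Re (x * y) = Re x * Re y - Im x * Im y.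
Proof. by case: x; case: y. Qed.

Lemma cImM (x y : R[i]) : Im (x * y) = Re x * Im y + Im x * Re y.
Proof. by case: x; case: y. Qed.

Lemma cintegrableZ (c : R[i]) f : cintegrable f -> cintegrable (fun t => c * f t).
Proof.
move=> [fr fi]; split.
  rewrite (_ : _ \o _ = (fun t => (Re c)%:E * (EFin \o (fun t => Re (f t))) t) \-
     (fun t => (Im c)%:E * (EFin \o (fun t => Im (f t))) t))%E.
    by apply: integrableB => //; apply: integrableZl.
  by apply/funext => t /=; rewrite cReM EFinB !EFinM.
rewrite (_ : _ \o _ = (fun t => (Re c)%:E * (EFin \o (fun t => Im (f t))) t) \+
     (fun t => (Im c)%:E * (EFin \o (fun t => Re (f t))) t))%E.
  by apply: integrableD => //; apply: integrableZl.
by apply/funext => t /=; rewrite cImM EFinD !EFinM.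
Qed.

Lemma cintegralZ (c : R[i]) f : cintegrable f ->
  cintegral (fun t => c * f t) = c * cintegral f.
Proof.
move=> [fr fi].
have ZR (k : R) : mu.-integrable setT (EFin \o (fun t => k * Re (f t))).
  rewrite (_ : _ \o _ = fun t => k%:E * (EFin \o (fun t => Re (f t))) t)%E//.
  exact: integrableZl.
have ZI (k : R) : mu.-integrable setT (EFin \o (fun t => k * Im (f t))).
  rewrite (_ : _ \o _ = fun t => k%:E * (EFin \o (fun t => Im (f t))) t)%E//.
  exact: integrableZl.
rewrite /cintegral.
under [X in X +i* _]eq_Rintegral do rewrite cReM.
under [X in _ +i* X]eq_Rintegral do rewrite cImM.
rewrite RintegralB// RintegralD// !RintegralZl//.
by case: c {ZR ZI} => a b.
Qed.

Lemma cintegral_conj h : cintegrable h ->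
  cintegral (fun t => conjc (h t)) = conjc (cintegral h).
Proof.
move=> [hr hi]; rewrite /cintegral.
rewrite (_ : (fun t => Re _) = (fun t => Re (h t))); last first.
  by apply/funext => t; case: (h t).
congr (_ +i* _).
rewrite (_ : (fun t => Im _) = (fun t => (-1) * (Im (h t)))); last first.
  by apply/funext => t; case: (h t) => x y /=; rewrite mulN1r.
by rewrite RintegralZl// mulN1r.
Qed.

Lemma eq_ae_Rintegral (f g : R -> R) :
  measurable_fun [set: Rm] f -> measurable_fun [set: Rm] g ->
  (\forall t \ae mu, f t = g t) -> \int[mu]_t f t = \int[mu]_t g t.
Proof.
move=> mf mg fg; rewrite /Rintegral; congr fine; apply: ae_eq_integral => //.
- exact/measurable_EFinP.
- exact/measurable_EFinP.
- by apply: filterS fg => t -> _.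
Qed.

Lemma eq_ae_cintegral (f g : R -> R[i]) : cmeas f -> cmeas g ->
  (\forall t \ae mu, f t = g t) -> cintegral f = cintegral g.
Proof.
move=> [fr fi] [gr gi] fg; rewrite /cintegral; congr (_ +i* _);
  by apply: eq_ae_Rintegral => //; apply: filterS fg => t ->.
Qed.

End ComplexIntegral.

Lemma cLp_exists d (T : measurableType d) (R : realType)
  (m : {measure set T -> \bar R}) (p : \bar R) (p1 : (1 <= p)%E) (u : T -> R[i]) :
  u \in cLfun m p1 -> exists f : cLp m p1, \forall t \ae m, cLp_fun f t = u t.
Proof. by move=> up; exists (cLp_class up); exact: cLp_class_fun. Qed.

(** * The inner product of L^2 *)

Section L2InnerProduct.
Variable R : realType.
Local Notation mu := (@circle_measure R).
Local Notation Rm := (measurableTypeR R).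
Local Notation normc := (@Normc.normc R).
Local Notation cmeas := (@cmeasurable _ Rm R).
Local Notation L2 := (L2T R).
Local Notation Loo := (LinfT R).

Lemma conjcD (x y : R[i]) : conjc (x + y) = conjc x + conjc y.
Proof. exact: rmorphD. Qed.

Lemma conjcM (x y : R[i]) : conjc (x * y) = conjc x * conjc y.
Proof. exact: rmorphM. Qed.

Lemma conjcN (x : R[i]) : conjc (- x) = - conjc x.
Proof. exact: rmorphN. Qed.

Lemma conjcX (x : R[i]) n : conjc (x ^+ n) = conjc x ^+ n.
Proof. exact: rmorphXn. Qed.

Definition sqint (u : R -> R[i]) :=
  cmeas u /\ mu.-integrable setT (EFin \o (fun t => sqrc (u t))).

Lemma L2_sqint (f : L2) : sqint (cLp_fun f).
Proof.
have [mf fp] := cLfunP (cLp_fun_Lfun f); split => //.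
have := Lfun2_integrable_sqr fp; congr (_.-integrable _ _).
by apply/funext => t /=; rewrite sqrc_normc.
Qed.

Lemma Linf_cmeas (phi : Loo) : cmeas (cLp_fun phi).
Proof. by have [] := cLfunP (cLp_fun_Lfun phi). Qed.

Lemma L2_cmeas (f : L2) : cmeas (cLp_fun f).
Proof. by have [] := L2_sqint f. Qed.

Lemma sqint_class u : sqint u ->
  exists f : L2, \forall t \ae mu, cLp_fun f t = u t.
Proof.
move=> [mu' /integrableP[_ iu]].
apply: (@cLp_exists _ Rm R mu 2%:E (lee1n 2)).
rewrite in_setE; split => //; apply/andP; split; rewrite in_setE /=.
  exact: cmeasurable_normc.
rewrite /finite_norm unlock; apply: poweR_lty.
apply: le_lt_trans iu; rewrite le_eqVlt; apply/orP; left; apply/eqP.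
apply: eq_integral => t _ /=.
rewrite !ger0_norm ?normc_ge0 ?sqrc_ge0//.
by rewrite powR_mulrn ?normc_ge0// sqrc_normc.
Qed.

Lemma sqint_prod u v : sqint u -> sqint v ->
  cintegrable (fun t => u t * conjc (v t)).
Proof.
move=> [mu' iu] [mv iv].
apply: (@cintegrable_le _ _ (fun t => sqrc (u t) + sqrc (v t))).
- by apply: cmeasurableM => //; exact: cmeasurable_conj.
- move=> t; rewrite Normc.normcM normc_conj !sqrc_normc.
  have := normc_ge0 (u t); have := normc_ge0 (v t).
  move: (normc (u t)) (normc (v t)) => x y; nra.
- rewrite (_ : _ \o _ = (EFin \o (fun t => sqrc (u t))) \+
     (EFin \o (fun t => sqrc (v t))))%E//.
  exact: integrableD.
Qed.

Lemma inner_integrable (f g : L2) :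
  cintegrable (fun t => cLp_fun f t * conjc (cLp_fun g t)).
Proof. by apply: sqint_prod; exact: L2_sqint. Qed.

Lemma L2_fun_comb (c : R[i]) (f g : L2) :
  \forall t \ae mu, cLp_fun (c *: f + g) t = c * cLp_fun f t + cLp_fun g t.
Proof.
apply: filterS2 (cLp_funD (c *: f : L2) g) (cLp_scaleE c f) => t.
by move=> -> <-.
Qed.

Lemma inner_lin (c : R[i]) (f g h : L2) :
  inner (c *: f + g) h = c * inner f h + inner g h.
Proof.
have i1 := inner_integrable f h; have i2 := inner_integrable g h.
rewrite {2 3}/inner -cintegralZ// -cintegralD//; last exact: cintegrableZ.
apply: eq_ae_cintegral.
- by apply: cmeasurableM; [|apply: cmeasurable_conj]; exact: L2_cmeas.
- apply: cmeasurableD; last first.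
    by apply: cmeasurableM; [|apply: cmeasurable_conj]; exact: L2_cmeas.
  apply: (cmeasurableM (cmeasurable_cst _ c)).
  by apply: cmeasurableM; [|apply: cmeasurable_conj]; exact: L2_cmeas.
- by apply: filterS (L2_fun_comb c f g) => t ->; rewrite mulrDl mulrA.
Qed.

Lemma inner_conj (f g : L2) : inner g f = conjc (inner f g).
Proof.
rewrite /inner -cintegral_conj; last exact: inner_integrable.
congr cintegral; apply/funext => t.
by rewrite conjcM conjcK mulrC.
Qed.

Lemma innerDl (f g h : L2) : inner (f + g) h = inner f h + inner g h.
Proof. by rewrite -{1}[f]scale1r inner_lin mul1r. Qed.

Lemma inner0l (h : L2) : inner 0 h = 0.
Proof. by apply: (@addIr _ (inner 0 h)); rewrite -innerDl !add0r. Qed.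

Lemma innerZl (c : R[i]) (f h : L2) : inner (c *: f) h = c * inner f h.
Proof. by rewrite -[c *: f]addr0 inner_lin inner0l addr0. Qed.

Lemma innerNl (f h : L2) : inner (- f) h = - inner f h.
Proof. by rewrite -scaleN1r innerZl mulN1r. Qed.

Lemma innerBl (f g h : L2) : inner (f - g) h = inner f h - inner g h.
Proof. by rewrite innerDl innerNl. Qed.

Lemma innerDr (f g h : L2) : inner h (f + g) = inner h f + inner h g.
Proof. by rewrite inner_conj innerDl conjcD -!inner_conj. Qed.

Lemma innerZr (c : R[i]) (f h : L2) : inner h (c *: f) = conjc c * inner h f.
Proof. by rewrite inner_conj innerZl conjcM -inner_conj. Qed.

Lemma innerNr (f h : L2) : inner h (- f) = - inner h f.
Proof. by rewrite inner_conj innerNl conjcN -inner_conj. Qed.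

Lemma innerBr (f g h : L2) : inner h (f - g) = inner h f - inner h g.
Proof. by rewrite innerDr innerNr. Qed.

Lemma inner0r (h : L2) : inner h 0 = 0.
Proof. by rewrite inner_conj inner0l conjc0. Qed.

(** All estimates are made on the square of the norm; the triangle inequality
    is replaced by [L2sqD_le], a consequence of the parallelogram identity. *)
Definition L2sq (f : L2) : R := \int[mu]_t sqrc (cLp_fun f t).

Lemma L2sq_inner (f : L2) : inner f f = (L2sq f)%:C.
Proof.
rewrite /inner /cintegral /L2sq; congr (_ +i* _).
  by apply: eq_Rintegral => t _; rewrite mul_conjc.
rewrite (_ : (fun t => _) = cst 0) ?Rintegral_cst ?mul0r//.
by apply/funext => t; rewrite mul_conjc.
Qed.

Lemma L2sq_ge0 (f : L2) : 0 <= L2sq f.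
Proof. by apply: Rintegral_ge0 => t _; exact: sqrc_ge0. Qed.

Lemma L2sq_EFin (f : L2) : (L2sq f)%:E = (\int[mu]_t (sqrc (cLp_fun f t))%:E)%E.
Proof.
have [_ i] := L2_sqint f.
by rewrite /L2sq /Rintegral fineK//; apply: integrable_fin_num.
Qed.

Lemma L2_fun0 : \forall t \ae mu, cLp_fun (0 : L2) t = 0.
Proof.
have := cLp_funD (0 : L2) 0; apply: filterS => t.
by rewrite addr0 => /eqP; rewrite -subr_eq0 opprD addNKr oppr_eq0 => /eqP.
Qed.

Lemma L2sq_eq0 (f : L2) : L2sq f = 0 -> f = 0.
Proof.
have [mf _] := L2_sqint f.
move=> f0; have {}f0 := congr1 EFin f0; rewrite L2sq_EFin in f0.
apply: (@cLp_ext _ Rm).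
have ms : measurable_fun [set: Rm] (EFin \o (fun t => sqrc (cLp_fun f t))).
  by apply/measurable_EFinP; exact: measurable_sqrc.
have H : ae_eq mu setT (EFin \o (fun t => sqrc (cLp_fun f t))) (cst 0%E).
  apply/(ae_eq_integral_abs mu measurableT ms).
  rewrite -[RHS]f0; apply: eq_integral => t _ /=.
  by rewrite ger0_norm ?sqrc_ge0.
apply: filterS2 H L2_fun0 => t /(_ I) [] /sqrc_eq0 -> -> //.
Qed.

End L2InnerProduct.

(** * Completeness of L^2 *)

Section Completeness.
Variable R : realType.
Local Notation mu := (@circle_measure R).
Local Notation Rm := (measurableTypeR R).
Local Notation cmeas := (@cmeasurable _ Rm R).
Local Notation Re := complex.Re.
Local Notation Im := complex.Im.
Local Notation L2 := (L2T R).

Lemma sum_half n : \sum_(k < n) (2^-1 : R) ^+ k <= 2.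
Proof.
suff -> : \sum_(k < n) (2^-1 : R) ^+ k = 2 - 2 * 2^-1 ^+ n.
  by rewrite gerBl mulr_ge0// exprn_ge0// invr_ge0.
elim: n => [|n IH]; first by rewrite big_ord0 expr0 mulr1 subrr.
by rewrite big_ord_recr /= IH exprS; field.
Qed.

(** The inequality |y| <= c y^2 + 1/c with c = 2^k turns summability of the
    weighted squares of the steps into summability of the steps. *)
Lemma cvg_weighted_steps (x : nat -> R) (M : R) :
  (forall n, \sum_(k < n) 2 ^+ k * (x k.+1 - x k) ^+ 2 <= M) ->
  cvgn x.
Proof.
move=> xM; set u := telescope x.
suff su : cvgn (series u).
  rewrite (_ : x = fun n => x 0%N + series u n); last first.
    by apply/funext => n; rewrite /u -eq_sum_telescope.
  by apply: is_cvgD => //; exact: is_cvg_cst.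
apply: normed_cvg.
apply: nondecreasing_is_cvgn.
  by apply: nondecreasing_series => n _ _; exact: normr_ge0.
exists (M + 2) => _ [n _ <-] /=.
rewrite /series /= big_mkord.
apply: (@le_trans _ _ (\sum_(k < n) (2 ^+ k * (x k.+1 - x k) ^+ 2 + 2^-1 ^+ k))).
  apply: ler_sum => k _; rewrite /u /telescope /= exprVn.
  have : 0 < (2 : R) ^+ k by rewrite exprn_gt0.
  move: (_ ^+ k) (x _.+1 - x _) => a y a0.
  rewrite -(real_normK (num_real y)).
  have := normr_ge0 y; move: (`|y|) => z z0.
  rewrite -(ler_pM2l a0) mulrDr divff ?gt_eqF//; nra.
by rewrite big_split /=; apply: lerD; [exact: xM|exact: sum_half].
Qed.

(** Only a bound valid from some rank on is required, so that the bound may be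
    taken as small as the tail of the sequence allows. *)
Lemma fatou_sqrc (v : nat -> R -> R[i]) (w : R -> R[i]) (B : R) :
  (forall j, cmeas (v j)) ->
  (\forall t \ae mu, (fun j => Re (v j t)) @ \oo --> Re (w t) /\
                     (fun j => Im (v j t)) @ \oo --> Im (w t)) ->
  (exists J, forall j, (J <= j)%N -> (\int[mu]_t (sqrc (v j t))%:E <= B%:E)%E) ->
  cmeas w ->
  (\int[mu]_t (sqrc (w t))%:E <= B%:E)%E.
Proof.
move=> mv vw [J vB] mw.
pose f j t := (sqrc (v (j + J)%N t))%:E.
have mf j : measurable_fun [set: Rm] (f j).
  by apply/measurable_EFinP; exact: measurable_sqrc.
have f0 j t : setT t -> (0 <= f j t)%E by move=> _; rewrite lee_fin sqrc_ge0.
have mlim : measurable_fun [set: Rm] (fun t => limn_einf (f ^~ t)).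
  rewrite /limn_einf; apply: measurableT_comp => //.
  apply: measurable_fun_limn_esup => n; apply: measurableT_comp => //.
have -> : (\int[mu]_t (sqrc (w t))%:E = \int[mu]_t limn_einf (f ^~ t))%E.
  apply: ae_eq_integral => //; first by apply/measurable_EFinP; exact: measurable_sqrc.
  apply: filterS vw => t [cr ci] _.
  have cf : f ^~ t @ \oo --> (sqrc (w t))%:E.
    apply: cvg_EFin; first exact: nearW.
    rewrite /f /comp /=.
    apply: (@cvg_comp _ _ _ (fun x => (x + J)%N) (fun j => sqrc (v j t)) \oo).
      exact: cvg_addnr.
    rewrite /sqrc; apply: cvgD.
      exact: (@cvg_comp _ _ _ _ (fun r : R => r ^+ 2) _ _ _ cr (@exprn_continuous R 2 _)).
    exact: (@cvg_comp _ _ _ _ (fun r : R => r ^+ 2) _ _ _ ci (@exprn_continuous R 2 _)).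
  by rewrite is_cvg_limn_einfE; [apply/esym/cvg_lim|apply/cvg_ex; eexists; exact: cf].
apply: (le_trans (fatou mu measurableT mf f0)).
rewrite limn_einf_lim; apply: lime_le; first exact: is_cvg_einfs.
apply: nearW => n; apply: (@le_trans _ _ (\int[mu]_t f n t)%E).
  by apply: ereal_inf_lbound; exists n => /=.
by apply: vB; rewrite leq_addl.
Qed.

(** The upper limit is a measurable function on the whole line that agrees with
    the limit at the points of convergence. *)
Lemma measurable_limit (x : nat -> R -> R) :
  (forall k, measurable_fun [set: Rm] (x k)) ->
  exists y : R -> R, measurable_fun [set: Rm] y /\
    forall t, cvgn (fun k => x k t) -> (fun k => x k t) @ \oo --> y t.
Proof.
move=> mx; exists (fun t => fine (limn_esup (fun k => (x k t)%:E))); split.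
  apply: measurableT_comp; first exact: fine_measurable.
  by apply: measurable_fun_limn_esup => k; exact/measurable_EFinP.
move=> t ct.
have ce : (fun k => (x k t)%:E) @ \oo --> (limn (fun k => x k t))%:E.
  by apply: cvg_EFin => //; exact: nearW.
have -> : limn_esup (fun k => (x k t)%:E) = (limn (fun k => x k t))%:E.
  rewrite is_cvg_limn_esupE; first exact/cvg_lim.
  by apply/cvg_ex; eexists; exact: ce.
exact: ct.
Qed.

Lemma L2_funB (f g : L2) :
  \forall t \ae mu, cLp_fun (f - g) t = cLp_fun f t - cLp_fun g t.
Proof.
have := L2_fun_comb (-1) g f; apply: filterS => t.
by rewrite scaleN1r mulN1r [- g + f]addrC [X in _ = X -> _]addrC.
Qed.

Lemma L2sqE (f : L2) u : cmeas u ->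
  (\forall t \ae mu, cLp_fun f t = u t) ->
  (L2sq f)%:E = (\int[mu]_t (sqrc (u t))%:E)%E.
Proof.
move=> mu' fu; rewrite L2sq_EFin; apply: ae_eq_integral => //.
- by apply/measurable_EFinP; apply: measurable_sqrc; exact: L2_cmeas.
- by apply/measurable_EFinP; apply: measurable_sqrc.
- by apply: filterS fu => t -> _.
Qed.

(** Riesz-Fischer for sequences that are Cauchy at a geometric rate. The series
    of the 2^k |s_(k+1) - s_k|^2 has a finite integral, hence is finite almost
    everywhere, and there [cvg_weighted_steps] gives pointwise convergence;
    Fatou's lemma then gives the rate for the norm of g - s_k. *)
Lemma L2_complete (s : nat -> L2) :
  (forall j k, (k <= j)%N -> L2sq (s j - s k) <= 4^-1 ^+ k) ->
  exists g : L2,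
    (\forall t \ae mu,
       (fun k => Re (cLp_fun (s k) t)) @ \oo --> Re (cLp_fun g t) /\
       (fun k => Im (cLp_fun (s k) t)) @ \oo --> Im (cLp_fun g t)) /\
    forall k, L2sq (g - s k) <= 4^-1 ^+ k.
Proof.
move=> hs.
pose S k (t : R) : R[i] := cLp_fun (s k) t.
have mS k : cmeas (S k) by exact: L2_cmeas.
have mSB k j : cmeas (S k - S j) by apply: cmeasurableD => //; exact: cmeasurableN.
pose w k (t : R) : R := 2 ^+ k * sqrc (S k.+1 t - S k t).
have w0 k t : 0 <= w k t by rewrite mulr_ge0 ?sqrc_ge0// exprn_ge0.
have mw k : measurable_fun [set: Rm] (EFin \o w k).
  apply/measurable_EFinP; apply: measurable_funM => //.
  exact: (measurable_sqrc (mSB k.+1 k)).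
have iw k : (\int[mu]_t (w k t)%:E <= (2^-1 ^+ k)%:E)%E.
  under eq_integral do rewrite /w EFinM.
  rewrite ge0_integralZl_EFin ?exprn_ge0//; last 2 first.
  - by move=> t _; rewrite lee_fin sqrc_ge0.
  - by apply/measurable_EFinP; exact: (measurable_sqrc (mSB k.+1 k)).
  rewrite -(@L2sqE (s k.+1 - s k) _ (mSB k.+1 k)); last exact: L2_funB.
  rewrite -EFinM lee_fin.
  apply: (le_trans (ler_wpM2l _ (hs _ _ (leqnSn k)))); first by rewrite exprn_ge0.
  rewrite -exprMn (_ : 2 * 4^-1 = 2^-1)//; lra.
pose W (t : R) : \bar R := (\sum_(k <oo) (w k t)%:E)%E.
have mW : measurable_fun [set: Rm] W.
  apply: (@ge0_emeasurable_sum _ Rm R setT (fun k t => (w k t)%:E)) => [k t _ _|k _].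
    by rewrite lee_fin.
  exact: mw.
have W0 t : (0 <= W t)%E by apply: nneseries_ge0 => k _ _; rewrite lee_fin.
have iW : mu.-integrable setT W.
  apply/integrableP; split => //.
  under eq_integral do rewrite gee0_abs//.
  rewrite integral_nneseries//; last by move=> k t _; rewrite lee_fin.
  apply: (@le_lt_trans _ _ 2%:E); last exact: ltry.
  apply: lime_le.
    by apply: is_cvg_nneseries => k _ _; apply: integral_ge0 => t _; rewrite lee_fin.
  apply: nearW => n; apply: (@le_trans _ _ (\sum_(0 <= k < n) (2^-1 ^+ k)%:E)%E).
    by apply: lee_sum => k _; exact: iw.
  by rewrite sumEFin lee_fin big_mkord; exact: sum_half.
have cae : \forall t \ae mu, cvgn (fun k => Re (S k t)) /\ cvgn (fun k => Im (S k t)).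
  apply: filterS (integrable_ae measurableT iW) => t /(_ I) Wfin.
  have wsum n : \sum_(k < n) w k t <= fine (W t).
    rewrite -lee_fin fineK// -sumEFin -(big_mkord xpredT (fun k => (w k t)%:E)).
    by apply: nneseries_lim_ge => k _; rewrite lee_fin.
  split; apply: (@cvg_weighted_steps _ (fine (W t))) => n;
    apply: le_trans (wsum n); apply: ler_sum => k _;
    apply: ler_wpM2l; rewrite ?exprn_ge0//.
    rewrite /sqrc (_ : Re (_ - _) = Re (S k.+1 t) - Re (S k t)).
      by rewrite lerDl sqr_ge0.
    by case: (S _ t); case: (S _ t).
  rewrite /sqrc (_ : Im (_ - _) = Im (S k.+1 t) - Im (S k t)).
    by rewrite lerDr sqr_ge0.
  by case: (S _ t); case: (S _ t).
have [x [mx cx]] := measurable_limit (fun k => (mS k).1).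
have [y [my cy]] := measurable_limit (fun k => (mS k).2).
pose G t := x t +i* y t.
have mG : cmeas G by [].
have cG : \forall t \ae mu, (fun k => Re (S k t)) @ \oo --> Re (G t) /\
       (fun k => Im (S k t)) @ \oo --> Im (G t).
  by apply: filterS cae => t [/cx ? /cy ?].
have mGS k : cmeas (G - S k) by apply: cmeasurableD => //; exact: cmeasurableN.
have bG k : (\int[mu]_t (sqrc (G t - S k t))%:E <= (4^-1 ^+ k)%:E)%E.
  apply: (@fatou_sqrc (fun j => S j - S k)) => //; last exact: (mGS k).
    apply: filterS cG => t [cr ci]; split.
      rewrite (_ : Re _ = Re (G t) - Re (S k t)); last first.
        by case: (G t) (S k t) => ? ? [].
      rewrite (_ : (fun j => _) = (fun j => Re (S j t) - Re (S k t))); last first.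
        by apply/funext => j; rewrite addrfctE opprfctE; case: (S j t) (S k t) => ? ? [].
      by apply: cvgB => //; exact: cvg_cst.
    rewrite (_ : Im _ = Im (G t) - Im (S k t)); last first.
      by case: (G t) (S k t) => ? ? [].
    rewrite (_ : (fun j => _) = (fun j => Im (S j t) - Im (S k t))); last first.
      by apply/funext => j; rewrite addrfctE opprfctE; case: (S j t) (S k t) => ? ? [].
    by apply: cvgB => //; exact: cvg_cst.
  exists k => j kj; rewrite -(@L2sqE (s j - s k) _ (mSB j k)); last exact: L2_funB.
  by rewrite lee_fin hs.
have sqG0 : sqint (G - S 0%N).
  split => //; apply/integrableP; split.
    by apply/measurable_EFinP; exact: measurable_sqrc.
  under eq_integral do rewrite gee0_abs ?lee_fin ?sqrc_ge0//.
  exact: (le_lt_trans (bG 0%N) (ltry _)).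
have [h hE] := sqint_class sqG0.
exists (h + s 0%N).
have gE : \forall t \ae mu, cLp_fun (h + s 0%N) t = G t.
  apply: filterS2 hE (cLp_funD (h : L2) (s 0%N)) => t h0.
  by move=> ->; rewrite h0 addrfctE opprfctE subrK.
split; first by apply: filterS2 gE cG => t ->.
move=> k; rewrite -lee_fin (@L2sqE _ (G - S k)) ?bG//.
by apply: filterS2 gE (L2_funB (h + s 0%N) (s k)) => t -> ->.
Qed.

End Completeness.

(** * Best approximation in a subspace *)

Section HilbertSpace.
Variable R : realType.
Local Notation mu := (@circle_measure R).
Local Notation Re := complex.Re.
Local Notation Im := complex.Im.
Local Notation L2 := (L2T R).

Lemma L2sqZ (c : R[i]) (f : L2) : L2sq (c *: f) = sqrc c * L2sq f.
Proof.
apply: complexI; rewrite -L2sq_inner innerZl innerZr L2sq_inner mulrA.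
by rewrite mul_conjc rmorphM.
Qed.

Lemma L2sqN (f : L2) : L2sq (- f) = L2sq f.
Proof. by apply: complexI; rewrite -!L2sq_inner innerNl innerNr opprK. Qed.

Lemma L2sq_parallelogram (f g : L2) :
  L2sq (f + g) + L2sq (f - g) = 2 * L2sq f + 2 * L2sq g.
Proof.
apply: complexI; rewrite !rmorphD !rmorphM /= -!L2sq_inner.
rewrite !(innerDl, innerDr, innerNl, innerNr) (_ : 2%:C = 2 :> R[i])//.
  ring.
by rewrite rmorph_nat.
Qed.

Lemma L2sqD_le (f g : L2) : L2sq (f + g) <= 2 * (L2sq f + L2sq g).
Proof. by rewrite mulrDr -L2sq_parallelogram lerDl L2sq_ge0. Qed.

(** Removing from f its component along g lowers the squared norm by exactly
    this amount. Nonnegativity of the left-hand side is the Cauchy-Schwarz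
    inequality; minimality of f modulo g forces the inner product to be small. *)
Lemma L2sq_residual (f g : L2) : L2sq g != 0 ->
  L2sq (f - (inner f g / (L2sq g)%:C) *: g) = L2sq f - sqrc (inner f g) / L2sq g.
Proof.
move=> g0; set c := _ / _; apply: complexI.
rewrite -L2sq_inner rmorphB rmorphM fmorphV /=.
have g0' : (L2sq g)%:C != 0 by apply: contra_neq g0 => -[].
rewrite !(innerBl, innerBr, innerZl, innerZr) (inner_conj f g) !L2sq_inner.
rewrite -mul_conjc /c conjcM.
rewrite (_ : conjc ((L2sq g)%:C)^-1 = ((L2sq g)%:C)^-1); last first.
  by rewrite conjc_inv conjc_real.
move: (inner f g) (conjc _) => x y; move: g0'; set l := (L2sq g)%:C => l0.
by field.
Qed.

Lemma L2sq_Schwarz (f g : L2) : sqrc (inner f g) <= L2sq f * L2sq g.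
Proof.
have [/L2sq_eq0 ->|g0] := eqVneq (L2sq g) 0.
  by rewrite inner0r /sqrc /= expr0n addr0 mulr_ge0// L2sq_ge0.
have gp : 0 < L2sq g by rewrite lt_neqAle eq_sym g0 L2sq_ge0.
have := L2sq_ge0 (f - (inner f g / (L2sq g)%:C) *: g).
by rewrite L2sq_residual// subr_ge0 ler_pdivrMr.
Qed.

Lemma geometric_le0 (y C : R) : (forall k, y <= C * 4^-1 ^+ k) -> y <= 0.
Proof.
move=> h.
have c0 : (fun k => C * 4^-1 ^+ k) @ \oo --> (0 : R).
  by apply: cvg_geometric; rewrite ger0_norm ?invf_lt1// ltr1n.
by apply: cvgr_to_ge c0 _; exact: nearW.
Qed.

Lemma sqrcD_le (x y : R[i]) : sqrc (x + y) <= 2 * (sqrc x + sqrc y).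
Proof.
case: x y => a b [c d]; rewrite /sqrc /=.
have := sqr_ge0 (a - c); have := sqr_ge0 (b - d); nra.
Qed.

(** The projection theorem without closedness: a minimizing sequence in V is
    Cauchy by the parallelogram identity, and its limit g is such that f - g is
    orthogonal to V. If V is closed, g is the projection of f on V; if only 0 is
    orthogonal to V, then g = f and V is dense. *)
Lemma L2_best_approximation (V : set L2) (f : L2) :
  V 0 -> (forall c g h, V g -> V h -> V (c *: g + h)) ->
  exists (s : nat -> L2) (g : L2),
    [/\ forall k, V (s k),
        \forall t \ae mu,
          (fun k => Re (cLp_fun (s k) t)) @ \oo --> Re (cLp_fun g t) /\
          (fun k => Im (cLp_fun (s k) t)) @ \oo --> Im (cLp_fun g t),
        forall k, L2sq (g - s k) <= 4^-1 ^+ k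
      & orthocomp V (f - g)].
Proof.
move=> V0 VL.
pose E := [set L2sq (f - v) | v in V].
have hE : has_inf E.
  split; first by exists (L2sq (f - 0)); exists 0.
  by exists 0 => _ [v _ <-]; exact: L2sq_ge0.
pose D := inf E.
have D_le v : V v -> D <= L2sq (f - v).
  by move=> Vv; apply: ge_inf; [exact: hE.2|exists v].
have e0 k : 0 < 4^-1 ^+ k / 4 :> R by rewrite divr_gt0// exprn_gt0// invr_gt0.
(* The slack 4^-k / 4 becomes, in the parallelogram identity, the rate 4^-k
   required for completeness. *)
have approx k : exists v, V v /\ L2sq (f - v) <= D + 4^-1 ^+ k / 4.
  have [_ [v Vv <-] vD] := inf_adherent (e0 k) hE.
  by exists v; split => //; exact: ltW.
have [s sP] := choice approx.
have Vs k : V (s k) by have [] := sP k.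
have sD k : L2sq (f - s k) <= D + 4^-1 ^+ k / 4 by have [] := sP k.
have e_le j k : (k <= j)%N -> 4^-1 ^+ j <= 4^-1 ^+ k :> R.
  by move=> kj; apply: ler_wiXn2l => //; rewrite invf_le1// ler1n.
have cauchy j k : (k <= j)%N -> L2sq (s j - s k) <= 4^-1 ^+ k.
  move=> kj.
  have := L2sq_parallelogram (f - s k) (f - s j).
  rewrite (_ : f - s k - (f - s j) = s j - s k); last first.
    by rewrite opprB addrC addrA subrK.
  rewrite (_ : f - s k + (f - s j) = 2 *: (f - (2^-1 *: s k + 2^-1 *: s j))).
    rewrite L2sqZ (_ : sqrc 2 = 4); last by rewrite /sqrc /=; ring.
    have : D <= L2sq (f - (2^-1 *: s k + 2^-1 *: s j)).
      by apply: D_le; apply: (VL) => //; rewrite -[_ *: _]addr0; apply: (VL).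
    have := sD k; have := sD j; have := e_le _ _ kj; lra.
  rewrite scalerBr scalerDr !scalerA divff// ?pnatr_eq0// !scale1r.
  by rewrite scaler_nat mulr2n opprD addrACA.
have [g [sg gB]] := L2_complete cauchy.
exists s, g; split => // h Vh.
have near k : sqrc (inner (f - s k) h) <= 4^-1 ^+ k / 4 * L2sq h.
  have [/L2sq_eq0 ->|h0] := eqVneq (L2sq h) 0.
    rewrite inner0r /sqrc /= expr0n addr0 mulr_ge0// ?L2sq_ge0//; exact: ltW.
  have hp : 0 < L2sq h by rewrite lt_neqAle eq_sym h0 L2sq_ge0.
  have := L2sq_residual (f - s k) h0.
  set c := _ / (L2sq h)%:C => cE.
  have : D <= L2sq (f - s k - c *: h).
    have -> : f - s k - c *: h = f - (c *: h + s k).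
      by rewrite opprD addrA addrAC.
    by apply: D_le; apply: (VL).
  rewrite cE -ler_pdivrMr// => ?; have := sD k; lra.
apply: sqrc_eq0; apply/le_anti; rewrite sqrc_ge0 andbT.
apply: (@geometric_le0 _ (4 * L2sq h)) => k.
have -> : inner (f - g) h = inner (f - s k) h + inner (- (g - s k)) h.
  by rewrite -innerDl opprB addrA subrK.
apply: (le_trans (sqrcD_le _ _)).
have := near k; have := L2sq_Schwarz (- (g - s k)) h; rewrite L2sqN.
have : L2sq (g - s k) * L2sq h <= 4^-1 ^+ k * L2sq h.
  by apply: ler_wpM2r => //; exact: L2sq_ge0.
have := L2sq_ge0 h; have := ltW (e0 k).
move: (inner _ _) (inner _ _) (L2sq h) (L2sq _) (4^-1 ^+ k) => x y N M e; nra.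
Qed.

End HilbertSpace.

(** * Multiplication operators and dominated convergence *)

Section Multiplication.
Variable R : realType.
Local Notation mu := (@circle_measure R).
Local Notation Rm := (measurableTypeR R).
Local Notation normc := (@Normc.normc R).
Local Notation cmeas := (@cmeasurable _ Rm R).
Local Notation Re := complex.Re.
Local Notation Im := complex.Im.
Local Notation L2 := (L2T R).
Local Notation Loo := (LinfT R).

Lemma ae_mem_itv : \forall t \ae mu, t \in `[(0 : R), 1[.
Proof.
exists (~` `[0, 1[%classic); split.
- by apply: measurableC; exact: measurable_itv.
- by rewrite /= /circle_measure /mrestr setICl measure0.
- by move=> t /= h; apply: contra_not h; rewrite inE.
Qed.

Lemma ae_lebesgue (P : R -> Prop) :
  (\forall t \ae (@lebesgue_measure R), P t) -> \forall t \ae mu, P t.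
Proof.
move=> [N [mN N0 PN]]; exists N; split => //.
apply/eqP; rewrite eq_le measure_ge0 andbT -N0 /circle_measure /mrestr.
apply: le_measure; rewrite ?inE//.
by apply: measurableI => //; exact: measurable_itv.
Qed.

Lemma ae_neq (x : R) : \forall t \ae mu, t != x.
Proof.
apply: ae_lebesgue; exists [set x]; split => //.
- exact: lebesgue_measure_set1.
- by move=> t /= /negP; rewrite negbK => /eqP.
Qed.

Lemma mulopE (phi : Loo) (f : L2) :
  \forall t \ae mu, cLp_fun (mulop phi f) t = cLp_fun phi t * cLp_fun f t.
Proof. exact: (@cLp_class_fun _ Rm R mu). Qed.

Lemma z_TE : \forall t \ae mu, cLp_fun (z_T R) t = circle_pt t.
Proof. exact: (@cLp_class_fun _ Rm R mu). Qed.

Lemma zbar_TE : \forall t \ae mu, cLp_fun (zbar_T R) t = conjc (circle_pt t).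
Proof. exact: (@cLp_class_fun _ Rm R mu). Qed.

Lemma one_TE : \forall t \ae mu, cLp_fun (one_T R) t = 1.
Proof. exact: (@cLp_class_fun _ Rm R mu). Qed.

Lemma L2_ext (f g : L2) :
  (\forall t \ae mu, cLp_fun f t = cLp_fun g t) -> f = g.
Proof. exact: (@cLp_ext _ Rm R mu). Qed.

Lemma mulop_lin (phi : Loo) c (f g : L2) :
  mulop phi (c *: f + g) = c *: mulop phi f + mulop phi g.
Proof.
apply: L2_ext.
apply: filterS3 (mulopE phi (c *: f + g)) (L2_fun_comb c f g)
  (filterI (mulopE phi f) (filterI (mulopE phi g)
  (L2_fun_comb c (mulop phi f) (mulop phi g)))) => t -> -> [E1 [E2 ->]].
by rewrite E1 E2 mulrDr mulrCA.
Qed.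

Lemma mulopDr (phi : Loo) (f g : L2) : mulop phi (f + g) = mulop phi f + mulop phi g.
Proof. by have := mulop_lin phi 1 f g; rewrite !scale1r. Qed.

Lemma mulop0 (phi : Loo) : mulop phi 0 = 0.
Proof. by apply: (@addIr _ (mulop phi 0)); rewrite -mulopDr !add0r. Qed.

Lemma mulopZ (phi : Loo) c (f : L2) : mulop phi (c *: f) = c *: mulop phi f.
Proof. by have := mulop_lin phi c f 0; rewrite mulop0 !addr0. Qed.

Lemma mulopBr (phi : Loo) (f g : L2) : mulop phi (f - g) = mulop phi f - mulop phi g.
Proof. by rewrite mulopDr -scaleN1r mulopZ scaleN1r. Qed.

Lemma mulopDl (phi psi : Loo) (f : L2) :
  mulop (phi + psi) f = mulop phi f + mulop psi f.
Proof.
apply: L2_ext.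
apply: filterS3 (mulopE (phi + psi) f) (cLp_funD phi psi)
  (filterI (mulopE phi f) (filterI (mulopE psi f)
  (cLp_funD (mulop phi f : L2) (mulop psi f)))) => t -> -> [E1 [E2 ->]].
by rewrite E1 E2 mulrDl.
Qed.

Lemma mulopC (phi psi : Loo) (f : L2) :
  mulop phi (mulop psi f) = mulop psi (mulop phi f).
Proof.
apply: L2_ext.
apply: filterS3 (mulopE phi (mulop psi f)) (mulopE psi (mulop phi f))
  (filterI (mulopE phi f) (mulopE psi f)) => t -> -> [-> ->].
by rewrite mulrCA.
Qed.

Lemma mulop_cancel (phi psi : Loo) (f : L2) :
  (\forall t \ae mu, cLp_fun phi t * cLp_fun psi t = 1) ->
  mulop phi (mulop psi f) = f.
Proof.
move=> pp; apply: L2_ext.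
apply: filterS3 (mulopE phi (mulop psi f)) (mulopE psi f) pp => t -> -> E.
by rewrite mulrA E mul1r.
Qed.

Lemma inner_mulop (phi psi : Loo) (f g : L2) :
  (\forall t \ae mu, cLp_fun psi t = conjc (cLp_fun phi t)) ->
  inner (mulop phi f) g = inner f (mulop psi g).
Proof.
move=> pp; apply: eq_ae_cintegral.
- by apply: cmeasurableM; [|apply: cmeasurable_conj]; exact: L2_cmeas.
- by apply: cmeasurableM; [|apply: cmeasurable_conj]; exact: L2_cmeas.
apply: filterS3 (mulopE phi f) (mulopE psi g) pp => t -> -> ->.
by rewrite conjcM conjcK mulrA [_ * cLp_fun f t]mulrC.
Qed.

Lemma circle_ptK (t : R) : circle_pt t * conjc (circle_pt t) = 1.
Proof.
by rewrite mul_conjc sqrc_normc circle_pt_normc expr1n.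
Qed.

Lemma zK (f : L2) : mulop (zbar_T R) (mulop (z_T R) f) = f.
Proof.
apply: mulop_cancel; apply: filterS2 z_TE zbar_TE => t -> ->.
by rewrite mulrC circle_ptK.
Qed.

Lemma zbarK (f : L2) : mulop (z_T R) (mulop (zbar_T R) f) = f.
Proof. by rewrite mulopC zK. Qed.

Lemma inner_z (f g : L2) : inner (mulop (z_T R) f) g = inner f (mulop (zbar_T R) g).
Proof. by apply: inner_mulop; apply: filterS2 z_TE zbar_TE => t -> ->. Qed.

Lemma inner_zbar (f g : L2) : inner (mulop (zbar_T R) f) g = inner f (mulop (z_T R) g).
Proof.
by apply: inner_mulop; apply: filterS2 z_TE zbar_TE => t -> ->; rewrite conjcK.
Qed.

Lemma Linf_exists (u : R -> R[i]) (K : R) : cmeas u ->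
  (\forall t \ae mu, normc (u t) <= K) ->
  exists phi : Loo, \forall t \ae mu, cLp_fun phi t = u t.
Proof.
move=> mu' uK; apply: (@cLp_exists _ Rm R mu +oo%E (leey 1)).
apply: (@cLfun_dominated _ Rm R mu +oo%E (leey 1) u (fun _ => K) mu' uK).
apply/andP; split; rewrite in_setE//=.
rewrite /finite_norm unlock; case: ifPn => // _.
by apply: le_lt_trans (ltry `|K|); apply/ess_supP/aeW.
Qed.

Lemma Linf_bounded (phi : Loo) :
  exists K : R, \forall t \ae mu, normc (cLp_fun phi t) <= K.
Proof. exact: (cLfun_oo_bounded (cLp_fun_Lfun phi)). Qed.

Lemma Linf_conj (phi : Loo) :
  exists psi : Loo, \forall t \ae mu, cLp_fun psi t = conjc (cLp_fun phi t).
Proof.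
have [K hK] := Linf_bounded phi.
apply: (@Linf_exists _ K); first by apply: cmeasurable_conj; exact: Linf_cmeas.
by apply: filterS hK => t; rewrite normc_conj.
Qed.

Lemma L2sq_le (K : R) (f g : L2) : 0 <= K ->
  (\forall t \ae mu, sqrc (cLp_fun f t) <= K * sqrc (cLp_fun g t)) ->
  L2sq f <= K * L2sq g.
Proof.
move=> K0 fg; rewrite -lee_fin EFinM !L2sq_EFin.
rewrite -ge0_integralZl_EFin//; last 2 first.
- by move=> t _; rewrite lee_fin sqrc_ge0.
- by apply/measurable_EFinP; apply: measurable_sqrc; exact: L2_cmeas.
apply: ae_ge0_le_integral => //.
- by move=> t _; rewrite lee_fin sqrc_ge0.
- by apply/measurable_EFinP; apply: measurable_sqrc; exact: L2_cmeas.
- by move=> t _; rewrite -EFinM lee_fin mulr_ge0// sqrc_ge0.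
- apply: measurable_funeM; apply/measurable_EFinP.
  by apply: measurable_sqrc; exact: L2_cmeas.
- by apply: filterS fg => t h _; rewrite -EFinM lee_fin.
Qed.

Lemma mulop_bounded (phi : Loo) :
  exists2 K, 0 <= K & forall f : L2, L2sq (mulop phi f) <= K * L2sq f.
Proof.
have [K hK] := Linf_bounded phi; exists (K ^+ 2); first exact: sqr_ge0.
move=> f; apply: L2sq_le; first exact: sqr_ge0.
apply: filterS2 hK (mulopE phi f) => t tK ->.
rewrite sqrcM; apply: ler_wpM2r; first exact: sqrc_ge0.
by rewrite sqrc_normc lerXn2r// nnegrE ?normc_ge0// (le_trans _ tK)// normc_ge0.
Qed.

(** Dominated convergence, applied to each part. Every limit taken below is
    that of a sequence of vanishing integrals. *)
Lemma cintegral_limit0 (h : nat -> R -> R[i]) (g : R -> R[i]) (k : R -> R) :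
  (forall n, cmeas (h n)) -> cmeas g ->
  (\forall t \ae mu, (fun n => Re (h n t)) @ \oo --> Re (g t) /\
                     (fun n => Im (h n t)) @ \oo --> Im (g t)) ->
  (forall n t, normc (h n t) <= k t) ->
  mu.-integrable setT (EFin \o k) ->
  (forall n, cintegral (h n) = 0) -> cintegral g = 0.
Proof.
move=> mh mg hg hk ik h0.
have mk := measurable_int _ ik.
have lim0 (p : R[i] -> R) : (forall z, `|p z| <= normc z) ->
    (forall n, measurable_fun [set: Rm] (fun t => p (h n t))) ->
    measurable_fun [set: Rm] (fun t => p (g t)) ->
    (\forall t \ae mu, (fun n => p (h n t)) @ \oo --> p (g t)) ->
    (forall n, \int[mu]_t p (h n t) = 0) -> \int[mu]_t p (g t) = 0.
  move=> pn mph mpg phg ph0.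
  have [ig _ cg] := @dominated_convergence _ Rm R mu setT measurableT
    (fun n t => (p (h n t))%:E) (fun t => (p (g t))%:E) (EFin \o k)
    (fun n => (measurable_EFinP _ _).2 (mph n)) ((measurable_EFinP _ _).2 mpg)
    ltac:(by apply: filterS phg => t ct _; apply: cvg_EFin => //; exact: nearW) ik
    ltac:(by apply: aeW => t n _; rewrite lee_fin (le_trans (pn _))).
  have z0 n : (\int[mu]_t (p (h n t))%:E = 0)%E.
    have := ph0 n; rewrite /Rintegral => e; rewrite -[LHS]fineK ?e//.
    apply: integrable_fin_num => //; apply: le_integrable ik => //.
      by apply/measurable_EFinP; exact: mph.
    move=> t _ /=; rewrite lee_fin (le_trans (pn _))// (le_trans (hk n t))//.
    exact: ler_norm.
  rewrite /Rintegral; move: cg.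
  rewrite (_ : (fun n => _) = fun _ => 0%E); last by apply/funext => n; exact: z0.
  move=> /cvg_lim <- //; rewrite lim_cst//.
have hE n : \int[mu]_t Re (h n t) = 0 /\ \int[mu]_t Im (h n t) = 0.
  by have := h0 n; rewrite /cintegral => -[].
rewrite /cintegral; congr (_ +i* _); apply: lim0.
- exact: normc_Re.
- by move=> n; have [] := mh n.
- by have [] := mg.
- by apply: filterS hg => t [].
- by move=> n; have [] := hE n.
- exact: normc_Im.
- by move=> n; have [] := mh n.
- by have [] := mg.
- by apply: filterS hg => t [].
- by move=> n; have [] := hE n.
Qed.

End Multiplication.

(** * Functions determined by their integrals over intervals *)

Section IntervalIntegrals.
Variable R : realType.
Local Notation mu := (@circle_measure R).
Local Notation leb := (@lebesgue_measure R).
Local Notation Rm := (measurableTypeR R).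

Lemma circle_integralE (A : set R) (f : R -> \bar R) :
  measurable (A : set Rm) -> A `<=` `[0, 1[%classic ->
  (\int[mu]_(t in A) f t = \int[leb]_(t in A) f t)%E.
Proof.
move=> mA A01; apply: eq_measure_integral => B mB BA.
by rewrite /= /circle_measure /mrestr setIidl//; exact: subset_trans A01.
Qed.

(** The primitive of p vanishes on ]0, 1[, and by Lebesgue's differentiation
    theorem its derivative is p almost everywhere. *)
Lemma ae0_of_interval_integrals (p : R -> R) :
  mu.-integrable setT (EFin \o p) ->
  (forall b, 0 < b < 1 -> \int[mu]_t (p t * \1_(`]0, b]%classic) t) = 0) ->
  \forall t \ae mu, p t = 0.
Proof.
move=> ip p0.
pose D : set R := `]0, 1[%classic.
have mD : measurable (D : set Rm) by exact: measurable_itv.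
have D01 : D `<=` `[0, 1[%classic.
  by move=> t; rewrite /D /= !in_itv /= => /andP[/ltW -> ->].
have ipD : mu.-integrable D (EFin \o p) by apply: integrableS ip.
have ilD : leb.-integrable D (EFin \o p).
  move/integrableP : ipD => [mp pfin]; apply/integrableP; split => //.
  by rewrite -circle_integralE.
have ilq : leb.-integrable setT (EFin \o (p \_ D)).
  have := (@integrable_mkcond _ Rm R leb D (EFin \o p) mD).1 ilD.
  by rewrite restrict_EFin.
have lq : locally_integrable setT (p \_ D) by exact: integrable_locally_restrict.
have F0 x : 0 < x < 1 -> \int[leb]_(t in `]-oo, x]) (p \_ D) t = 0.
  move=> /[dup] x01 /andP[x0 x1].
  have mx : measurable (`]0, x]%classic : set Rm) by exact: measurable_itv.
  rewrite -(p0 x x01) /Rintegral; congr fine.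
  have E : (EFin \o (p \_ D)) \_ `]-oo, x]%classic = (EFin \o p) \_ `]0, x]%classic.
    apply/funext => t; rewrite /patch /=.
    have -> : (t \in (`]0, x]%classic : set R)) =
       (t \in (`]-oo, x]%classic : set R)) && (t \in D).
      rewrite /D !mem_setE !in_itv /=; apply/idP/idP.
        by move=> /andP[-> tx]; rewrite tx /=; exact: le_lt_trans tx x1.
      by move=> /andP[-> /andP[-> _]].
    by case: ifPn => //= _; case: ifPn.
  transitivity (\int[leb]_t ((EFin \o (p \_ D)) \_ `]-oo, x]%classic) t)%E.
    by rewrite integral_mkcond.
  rewrite E.
  rewrite -integral_mkcond -circle_integralE//; last first.
    by move=> t; rewrite /= !in_itv /= => /andP[/ltW -> /le_lt_trans ->].
  rewrite [in LHS]integral_mkcond; apply: eq_integral => t _.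
  rewrite /patch indicE /=; case: ifPn => _; first by rewrite mulr1.
  by rewrite mulr0.
have ilqy y : leb.-integrable `]-oo, y] (EFin \o (p \_ D)).
  by apply: (integrableS _ _ _ ilq) => //; exact: measurable_itv.
have := FTC1Ny ilqy lq.
move=> /= /ae_lebesgue H.
apply: filterS3 H (ae_mem_itv R) (ae_neq 0) => t [_ Ft] t01 tn0.
have {tn0}t01' : 0 < t < 1.
  move: t01; rewrite in_itv /= => /andP[t0 ->]; rewrite andbT.
  by rewrite lt_neqAle eq_sym tn0.
have pt : (p \_ D) t = p t.
  by rewrite /patch ifT// inE /D /= in_itv.
rewrite -pt -Ft derive1E (@near_eq_derive _ _ _ _ (cst 0)) ?derive_cst//.
have : t \in `]0, 1[ by rewrite in_itv.
move=> /near_in_itvoo; apply: filterS => x; rewrite in_itv /= => x01.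
exact: F0.
Qed.

Lemma bernoulli_le (y : R) m : 0 <= y <= 1 -> 1 - m%:R * y <= (1 - y) ^+ m.
Proof.
move=> /andP[y0 y1]; elim: m => [|m IH]; first by rewrite mul0r subr0 expr0.
rewrite exprS; have := ler_wpM2l (_ : 0 <= 1 - y) IH.
rewrite subr_ge0 => /(_ y1); apply: le_trans.
by rewrite -natr1; have : 0 <= m%:R :> R by []; nra.
Qed.

Lemma bernoulli_ge (y : R) m : 0 <= y <= 1 -> (1 - y) ^+ m * (1 + m%:R * y) <= 1.
Proof.
move=> /andP[y0 y1]; elim: m => [|m IH]; first by rewrite expr0 mul0r addr0 mulr1.
apply: le_trans IH; rewrite exprSr -mulrA; apply: ler_wpM2l.
  by rewrite exprn_ge0// subr_ge0.
by rewrite -natr1; have : 0 <= m%:R :> R by []; nra.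
Qed.

(** The polynomials of the Brosowski-Deutsch proof of the Stone-Weierstrass
    theorem: on [0, 1] they stay between 0 and 1, tend to 1 below 1/2, and to 0
    above 1/2. Both limits come from Bernoulli's inequality, as 2^n x^n is
    (2 x)^n. *)
Definition step_pow (x : R) n := (1 - x ^+ n) ^+ (2 ^ n).

Lemma step_pow_bound x n : 0 <= x <= 1 -> 0 <= step_pow x n <= 1.
Proof.
move=> /andP[x0 x1]; have e1 := exprn_ile1 n x0 x1; have e0 := exprn_ge0 n x0.
have y0 : 0 <= 1 - x ^+ n by rewrite subr_ge0.
by rewrite /step_pow exprn_ge0//= exprn_ile1// lerBlDr lerDl.
Qed.

Lemma step_pow_below x : 0 <= x < 2^-1 -> step_pow x @ \oo --> (1 : R).
Proof.
move=> /andP[x0 x2].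
have x1 : 0 <= x <= 1 by rewrite x0 /=; lra.
apply: (@squeeze_cvgr _ _ _ _ (fun n => 1 - (2 * x) ^+ n) (fun _ => 1)).
- apply: nearW => n; have /andP[_ ->] := step_pow_bound n x1.
  rewrite andbT (le_trans _ (bernoulli_le _ _))//; last first.
    by move: x1 => /andP[? ?]; rewrite exprn_ge0// exprn_ile1.
  by rewrite exprMn natrX.
- rewrite -[X in _ --> X]subr0; apply: cvgB; first exact: cvg_cst.
  by apply: cvg_expr; rewrite ger0_norm; lra.
- exact: cvg_cst.
Qed.

Lemma step_pow_above x : 2^-1 < x <= 1 -> step_pow x @ \oo --> (0 : R).
Proof.
move=> /andP[x2 x1].
have xx : 0 <= x <= 1 by rewrite x1 andbT; lra.
have x0 : 0 < 2 * x by lra.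
apply: (@squeeze_cvgr _ _ _ _ (fun _ => 0) (fun n => (2 * x)^-1 ^+ n)).
- apply: nearW => n; have /andP[s0 _] := step_pow_bound n xx; rewrite s0 /=.
  have yy : 0 <= x ^+ n <= 1 by move: xx => /andP[? ?]; rewrite exprn_ge0// exprn_ile1.
  have := bernoulli_ge (2 ^ n) yy; rewrite -/(step_pow x n) natrX -exprMn => h.
  have e0 : 0 < (2 * x) ^+ n by rewrite exprn_gt0.
  by rewrite exprVn -[leRHS]mul1r ler_pdivlMr//; nra.
- exact: cvg_cst.
- apply: cvg_expr; rewrite ger0_norm; last by rewrite invr_ge0 ltW.
  by rewrite invf_lt1//; lra.
Qed.

End IntervalIntegrals.

(** * Density of trigonometric polynomials *)

Section TrigonometricPolynomials.
Variable R : realType.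
Local Notation mu := (@circle_measure R).
Local Notation Rm := (measurableTypeR R).
Local Notation normc := (@Normc.normc R).
Local Notation cmeas := (@cmeasurable _ Rm R).
Local Notation Re := complex.Re.
Local Notation Im := complex.Im.
Local Notation L2 := (L2T R).

(** Generated from the constant 1 by the two shifts rather than given by a sum
    of modes: an operator commuting with the shifts is then computed on
    trigonometric polynomials by induction, from its value at 1. *)
Inductive trigpoly : L2 -> Prop :=
| trig_one : trigpoly (one_T R)
| trig_lin c f g : trigpoly f -> trigpoly g -> trigpoly (c *: f + g)
| trig_z f : trigpoly f -> trigpoly (mulop (z_T R) f)
| trig_zbar f : trigpoly f -> trigpoly (mulop (zbar_T R) f).

Lemma trig0 : trigpoly 0.
Proof. by rewrite -(addNr (one_T R)) -scaleN1r; apply: trig_lin; exact: trig_one. Qed.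

(** Products of trigonometric polynomials are handled through the functions
    that act on them by multiplication, a class closed under sums and
    products. *)
Definition trig_multiplier (u : R -> R[i]) :=
  cmeas u /\ forall h, trigpoly h ->
    exists2 h', trigpoly h' & \forall t \ae mu, cLp_fun h' t = u t * cLp_fun h t.

Lemma trig_multiplier_cst c : trig_multiplier (fun _ => c).
Proof.
split; first exact: (cmeasurable_cst _ c).
move=> h th; exists (c *: h + 0); first by apply: trig_lin => //; exact: trig0.
by apply: filterS2 (L2_fun_comb c h 0) (L2_fun0 R) => t -> ->; rewrite addr0.
Qed.

Lemma trig_multiplier_z : trig_multiplier (@circle_pt R).
Proof.
split; first exact: circle_pt_cmeasurable.
move=> h th; exists (mulop (z_T R) h); first exact: trig_z.
by apply: filterS2 (mulopE (z_T R) h) (z_TE R) => t -> ->.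
Qed.

Lemma trig_multiplier_zbar : trig_multiplier (fun t => conjc (@circle_pt R t)).
Proof.
split; first exact: circle_ptC_cmeasurable.
move=> h th; exists (mulop (zbar_T R) h); first exact: trig_zbar.
by apply: filterS2 (mulopE (zbar_T R) h) (zbar_TE R) => t -> ->.
Qed.

Lemma trig_multiplierD u v : trig_multiplier u -> trig_multiplier v ->
  trig_multiplier (fun t => u t + v t).
Proof.
move=> [mu' tu] [mv tv]; split; first exact: (cmeasurableD mu' mv).
move=> h th; have [h1 t1 e1] := tu h th; have [h2 t2 e2] := tv h th.
exists (1 *: h1 + h2); first exact: trig_lin.
by apply: filterS3 (L2_fun_comb 1 h1 h2) e1 e2 => t -> -> ->; rewrite mul1r mulrDl.
Qed.

Lemma trig_multiplierM u v : trig_multiplier u -> trig_multiplier v ->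
  trig_multiplier (fun t => u t * v t).
Proof.
move=> [mu' tu] [mv tv]; split; first exact: (cmeasurableM mu' mv).
move=> h th; have [h1 t1 e1] := tv h th; have [h2 t2 e2] := tu h1 t1.
by exists h2 => //; apply: filterS2 e1 e2 => t E ->; rewrite E mulrA.
Qed.

Lemma trig_multiplierX u n : trig_multiplier u -> trig_multiplier (fun t => u t ^+ n).
Proof.
move=> tu; elim: n => [|n IH]; first exact: trig_multiplier_cst.
rewrite (_ : (fun t => _) = fun t => u t * u t ^+ n).
  exact: trig_multiplierM.
by apply/funext => t; rewrite exprS.
Qed.

(** For t in ]0, 1[ the first sine is positive and the second changes sign at
    b, so this function crosses the value 1/2 exactly at b. The product of sines
    is a difference of cosines, hence a trigonometric polynomial in t. *)
Definition circle_step (b t : R) : R :=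
  2^-1 + sin (trigo.pi * t) * sin (trigo.pi * (t - b)) / 2.

Lemma circle_step_bound b t : 0 <= circle_step b t <= 1.
Proof.
have : `|sin (trigo.pi * t) * sin (trigo.pi * (t - b))| <= 1 :> R.
  by rewrite normrM mulr_ile1// sin_max.
rewrite ler_norml /circle_step => /andP[? ?]; apply/andP; split; lra.
Qed.

Lemma trig_multiplier_step b : trig_multiplier (fun t => (circle_step b t)%:C).
Proof.
pose e : R[i] := cos (trigo.pi * b) +i* sin (trigo.pi * b).
pose r : R := 2^-1 + cos (trigo.pi * b) / 4.
rewrite (_ : (fun t => _) = fun t => r%:C +
   (((- 8^-1)%:C * conjc e) * circle_pt t + ((- 8^-1)%:C * e) * conjc (circle_pt t))).
  apply: trig_multiplierD; first exact: trig_multiplier_cst.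
  apply: trig_multiplierD; apply: trig_multiplierM; try exact: trig_multiplier_cst.
    exact: trig_multiplier_z.
  exact: trig_multiplier_zbar.
apply/funext => t; rewrite /circle_step /circle_pt /e /r.
rewrite (_ : 2 * trigo.pi * t = trigo.pi * t + trigo.pi * t); last by ring.
rewrite mulrBr sinB cosD sinD.
have h := cos2Dsin2 (trigo.pi * t).
apply/eqP; rewrite eq_complex /=; apply/andP; split; apply/eqP; last by ring.
set C := cos (trigo.pi * t) in h *; set S := sin (trigo.pi * t) in h *.
have -> : C * C = 1 - S * S by move: h; rewrite !expr2 => <-; ring.
by field.
Qed.

Lemma circle_step_below b t : 0 < t -> t < b -> b < 1 -> circle_step b t < 2^-1.
Proof.
move=> t0 tb b1; rewrite /circle_step gtrDl pmulr_llt0// nmulr_llt0//.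
  apply: sin_gt0_pi; rewrite mulr_gt0//= ?pi_gt0// -[ltRHS]mulr1 ltr_pM2l ?pi_gt0//.
  exact: lt_trans b1.
rewrite -opprB mulrN sinN oppr_lt0; apply: sin_gt0_pi.
rewrite mulr_gt0 ?pi_gt0 ?subr_gt0//= -[ltRHS]mulr1 ltr_pM2l ?pi_gt0//; lra.
Qed.

Lemma circle_step_above b t : 0 < b -> b < t -> t < 1 -> 2^-1 < circle_step b t.
Proof.
move=> b0 tb t1; rewrite /circle_step ltrDl !mulr_gt0//; apply: sin_gt0_pi.
  rewrite mulr_gt0//= ?pi_gt0 ?(lt_trans b0)// -[ltRHS]mulr1 ltr_pM2l ?pi_gt0//.
rewrite mulr_gt0 ?pi_gt0 ?subr_gt0//= -[ltRHS]mulr1 ltr_pM2l ?pi_gt0//; lra.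
Qed.

Lemma trig_multiplier_orth (f : L2) u :
  (forall h, trigpoly h -> inner f h = 0) -> trig_multiplier u ->
  cintegral (fun t => cLp_fun f t * conjc (u t)) = 0.
Proof.
move=> f0 [mu' /(_ _ trig_one)[h th hE]]; rewrite -(f0 h th).
apply: eq_ae_cintegral.
- by apply: cmeasurableM; [exact: L2_cmeas|exact: cmeasurable_conj].
- by apply: cmeasurableM; [|apply: cmeasurable_conj]; exact: L2_cmeas.
- by apply: filterS2 hE (one_TE R) => t -> ->; rewrite mulr1.
Qed.

(** Dominating functions: |f| <= 1 + |f|^2 and the total mass is finite. *)
Lemma normc_bound_integrable (f : L2) (K : R) : 0 <= K ->
  exists2 k : R -> R, mu.-integrable setT (EFin \o k)
    & forall t, K * normc (cLp_fun f t) <= k t.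
Proof.
move=> K0; have [_ i2] := L2_sqint f.
exists (fun t => K + K * sqrc (cLp_fun f t)).
  rewrite (_ : _ \o _ = (EFin \o cst K) \+
     (fun t => K%:E * (EFin \o (fun t => sqrc (cLp_fun f t))) t))%E.
    apply: integrableD => //; last exact: integrableZl.
    exact: finite_measure_integrable_cst.
  by apply/funext => t /=.
move=> t; rewrite -[X in X + _]mulr1 -mulrDr.
apply: ler_wpM2l => //; rewrite sqrc_normc.
by have := sqr_ge0 (normc (cLp_fun f t) - 2^-1); nra.
Qed.

(** Applying [step_pow] to [circle_step] gives uniformly bounded trigonometric
    polynomials that tend to the indicator of ]0, b]. By dominated convergence f
    has a zero integral over every ]0, b], hence vanishes almost everywhere. *)
Lemma trig_total (f : L2) : (forall h, trigpoly h -> inner f h = 0) -> f = 0.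
Proof.
move=> f0.
have key b : 0 < b < 1 ->
    cintegral (fun t => cLp_fun f t * (\1_(`]0, b]%classic) t)%:C) = 0.
  move=> /andP[b0 b1].
  pose u n t : R[i] := (1 + (-1) * (circle_step b t)%:C ^+ n) ^+ (2 ^ n).
  have tu n : trig_multiplier (u n).
    apply: trig_multiplierX; apply: trig_multiplierD; first exact: trig_multiplier_cst.
    apply: trig_multiplierM; first exact: trig_multiplier_cst.
    by apply: trig_multiplierX; exact: trig_multiplier_step.
  pose h n t := cLp_fun f t * conjc (u n t).
  have hE n t : h n t = cLp_fun f t * (step_pow (circle_step b t) n)%:C.
    rewrite /h /u /step_pow mulN1r -[X in conjc ((X - _) ^+ _)]/(1%:C).
    by rewrite -(rmorphXn (real_complex R)) -rmorphB -rmorphXn conjc_real.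
  have [k ik kP] := normc_bound_integrable f ler01.
  apply: (@cintegral_limit0 _ h _ k) => //.
  - move=> n; apply: cmeasurableM; first exact: L2_cmeas.
    by apply: cmeasurable_conj; have [] := tu n.
  - apply: cmeasurableM; first exact: L2_cmeas.
    split; last exact: measurable_cst.
    by apply: measurable_indic; exact: measurable_itv.
  - have cvgC (z : R[i]) (x : nat -> R) (l : R) : x @ \oo --> l ->
       (fun n => Re (z * (x n)%:C)) @ \oo --> Re (z * l%:C) /\
       (fun n => Im (z * (x n)%:C)) @ \oo --> Im (z * l%:C).
      move=> xl; split; rewrite ?cReM ?cImM /=.
        under eq_fun do rewrite cReM /= mulr0 subr0.
        by rewrite mulr0 subr0; apply: cvgM => //; exact: cvg_cst.
      under eq_fun do rewrite cImM /= mulr0 add0r.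
      by rewrite mulr0 add0r; apply: cvgM => //; exact: cvg_cst.
    apply: filterS3 (ae_mem_itv R) (ae_neq 0) (ae_neq b) => t t01 t0 tb.
    have {t0} tpos : 0 < t.
      by move: t01; rewrite in_itv /= => /andP[t0' _]; rewrite lt_neqAle eq_sym t0.
    have {t01} t1 : t < 1 by move: t01; rewrite in_itv /= => /andP[].
    rewrite (_ : h = fun n t => cLp_fun f t * (step_pow (circle_step b t) n)%:C);
      last by apply/funext => n; apply/funext.
    apply: cvgC; have /andP[x0 x1] := circle_step_bound b t.
    rewrite indicE mem_setE in_itv /= tpos /=.
    have [tb'|tb'] := ltP t b.
      rewrite ltW//; apply: step_pow_below; rewrite x0 /=; exact: circle_step_below.
    have bt : b < t by rewrite lt_neqAle eq_sym tb.
    rewrite leNgt bt /=; apply: step_pow_above; rewrite x1 andbT.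
    exact: circle_step_above.
  - move=> n t; rewrite hE (le_trans _ (kP t))// mul1r Normc.normcM.
    have /andP[s0 s1] := step_pow_bound n (circle_step_bound b t).
    rewrite -[leRHS]mulr1 ler_wpM2l ?normc_ge0//.
    by rewrite normc_def2 /= expr0n addr0 sqrtr_sqr ger0_norm.
  - by move=> n; exact: trig_multiplier_orth.
have [k ik kP] := normc_bound_integrable f ler01.
have [ir ii] : cintegrable (cLp_fun f).
  by apply: (cintegrable_le (L2_cmeas f) _ ik) => t; rewrite -[leLHS]mul1r.
have re0 : \forall t \ae mu, Re (cLp_fun f t) = 0.
  apply: ae0_of_interval_integrals => // b /key; rewrite /cintegral => -[+ _].
  by apply: etrans; apply: eq_Rintegral => t _; rewrite cReM /= mulr0 subr0.
have im0 : \forall t \ae mu, Im (cLp_fun f t) = 0.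
  apply: ae0_of_interval_integrals => // b /key; rewrite /cintegral => -[_].
  by apply: etrans; apply: eq_Rintegral => t _; rewrite cImM /= mulr0 add0r.
apply: L2_ext; apply: filterS3 re0 im0 (L2_fun0 R) => t.
by case: (cLp_fun f t) => x y /= -> -> ->.
Qed.

Lemma trig_dense (f : L2) : exists s : nat -> L2,
  [/\ forall k, trigpoly (s k),
      \forall t \ae mu,
          (fun k => Re (cLp_fun (s k) t)) @ \oo --> Re (cLp_fun f t) /\
          (fun k => Im (cLp_fun (s k) t)) @ \oo --> Im (cLp_fun f t)
    & forall k, L2sq (f - s k) <= 4^-1 ^+ k].
Proof.
have [s [g [ts cs ds fg]]] := L2_best_approximation f trig0 trig_lin.
have fgE : f = g by apply/subr0_eq/trig_total.
by exists s; rewrite fgE.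
Qed.

End TrigonometricPolynomials.

(** * The commutant of multiplication by z *)

Section Commutant.
Variable R : realType.
Local Notation mu := (@circle_measure R).
Local Notation Rm := (measurableTypeR R).
Local Notation cmeas := (@cmeasurable _ Rm R).
Local Notation Re := complex.Re.
Local Notation Im := complex.Im.
Local Notation L2 := (L2T R).
Local Notation Loo := (LinfT R).

Lemma L2norm_L2sq (f : L2) : L2norm f = Num.sqrt (L2sq f).
Proof. by rewrite /L2norm L2sq_inner. Qed.

Lemma bounded_operator_L2sq (X : L2 -> L2) : bounded_operator X ->
  exists2 K, 0 <= K & forall f, L2sq (X f) <= K * L2sq f.
Proof.
move=> [K hK]; exists (K ^+ 2) => [|f]; first exact: sqr_ge0.
have h : Num.sqrt (L2sq (X f)) <= `|K| * Num.sqrt (L2sq f).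
  rewrite -!L2norm_L2sq; apply: (le_trans (hK f)).
  by apply: ler_wpM2r; [rewrite L2norm_L2sq sqrtr_ge0|exact: ler_norm].
rewrite -(sqr_sqrtr (L2sq_ge0 (X f))) -(sqr_sqrtr (L2sq_ge0 f)).
rewrite -(real_normK (num_real K)) -exprMn lerXn2r// nnegrE ?sqrtr_ge0//.
Qed.

Section CommutingOperator.
Variables (Y : L2 -> L2) (K : R).
Hypothesis Ylin : forall c f g, Y (c *: f + g) = c *: Y f + Y g.
Hypothesis K0 : 0 <= K.
Hypothesis YK : forall f, L2sq (Y f) <= K * L2sq f.
Hypothesis Yz : forall f, Y (mulop (z_T R) f) = mulop (z_T R) (Y f).

Let r := cLp_fun (Y (one_T R)).

(** Commutation with M_z implies commutation with its inverse, so Y acts on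
    trigonometric polynomials as multiplication by Y 1. *)
Lemma commuting_trigpoly p : trigpoly p ->
  \forall t \ae mu, cLp_fun (Y p) t = r t * cLp_fun p t.
Proof.
elim=> [|c f g _ IHf _ IHg|f _ IH|f _ IH].
- by apply: filterS (one_TE R) => t ->; rewrite mulr1.
- rewrite Ylin; apply: filterS3 (L2_fun_comb c f g) (L2_fun_comb c (Y f) (Y g))
    (filterI IHf IHg) => t -> -> [-> ->].
  by rewrite mulrDr mulrCA.
- rewrite Yz; apply: filterS3 (mulopE (z_T R) f) (mulopE (z_T R) (Y f)) IH.
  by move=> t -> -> ->; rewrite mulrCA.
- have -> : Y (mulop (zbar_T R) f) = mulop (zbar_T R) (Y f).
    by rewrite -{2}(zbarK f) Yz zK.
  apply: filterS3 (mulopE (zbar_T R) f) (mulopE (zbar_T R) (Y f)) IH.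
  by move=> t -> -> ->; rewrite mulrCA.
Qed.

(** Take trigonometric polynomials s_j tending to f in norm and almost
    everywhere. Then Y f - r s_j = Y (f - s_j) tends to 0 in norm and to Y f - r f
    almost everywhere, so Fatou's lemma gives Y f = r f, although r f is not yet
    known to be square integrable. *)
Lemma commuting_pointwise f : \forall t \ae mu, cLp_fun (Y f) t = r t * cLp_fun f t.
Proof.
have mr : cmeas r by exact: L2_cmeas.
have [s [ts cs ds]] := trig_dense f.
pose w t := cLp_fun (Y f) t - r t * cLp_fun f t.
pose v j t := cLp_fun (Y f) t - r t * cLp_fun (s j) t.
have mw : cmeas w.
  apply: (cmeasurableD (L2_cmeas _)); apply: cmeasurableN.
  by apply: cmeasurableM => //; exact: L2_cmeas.
have mv j : cmeas (v j).
  apply: (cmeasurableD (L2_cmeas _)); apply: cmeasurableN.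
  by apply: cmeasurableM => //; exact: L2_cmeas.
have vE j : \forall t \ae mu, cLp_fun (Y f - Y (s j)) t = v j t.
  apply: filterS2 (L2_funB (Y f) (Y (s j))) (commuting_trigpoly (ts j)).
  by move=> t -> ->.
have iw m : (\int[mu]_t (sqrc (w t))%:E <= (K * 4^-1 ^+ m)%:E)%E.
  apply: (fatou_sqrc mv _ _ mw).
    apply: filterS cs => t [cr ci]; rewrite /v /w; split.
      rewrite (_ : Re (_ - _) = Re (cLp_fun (Y f) t) -
        (Re (r t) * Re (cLp_fun f t) - Im (r t) * Im (cLp_fun f t))); last first.
        by case: (cLp_fun (Y f) t) (r t) (cLp_fun f t) => ? ? [? ?] [].
      rewrite (_ : (fun j => _) = fun j => Re (cLp_fun (Y f) t) -
        (Re (r t) * Re (cLp_fun (s j) t) - Im (r t) * Im (cLp_fun (s j) t))).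
        apply: cvgB; first exact: cvg_cst.
        by apply: cvgB; apply: cvgM => //; exact: cvg_cst.
      by apply/funext => j; case: (cLp_fun (Y f) t) (r t) (cLp_fun (s j) t) => ? ? [? ?] [].
    rewrite (_ : Im (_ - _) = Im (cLp_fun (Y f) t) -
        (Re (r t) * Im (cLp_fun f t) + Im (r t) * Re (cLp_fun f t))); last first.
      by case: (cLp_fun (Y f) t) (r t) (cLp_fun f t) => ? ? [? ?] [].
    rewrite (_ : (fun j => _) = fun j => Im (cLp_fun (Y f) t) -
        (Re (r t) * Im (cLp_fun (s j) t) + Im (r t) * Re (cLp_fun (s j) t))).
      apply: cvgB; first exact: cvg_cst.
      by apply: cvgD; apply: cvgM => //; exact: cvg_cst.
    by apply/funext => j; case: (cLp_fun (Y f) t) (r t) (cLp_fun (s j) t) => ? ? [? ?] [].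
  exists m => j mj; rewrite -(L2sqE (mv j) (vE j)) lee_fin.
  rewrite -[Y f]scale1r addrC -scaleN1r [X in L2sq X](_ : _ = Y (-1 *: s j + f)).
    apply: (le_trans (YK _)); apply: ler_wpM2l => //.
    rewrite scaleN1r addrC; apply: (le_trans (ds j)).
    by apply: ler_wiXn2l => //; rewrite invf_le1// ler1n.
  by rewrite Ylin scale1r.
have [h hE] : exists h : L2, \forall t \ae mu, cLp_fun h t = w t.
  apply: sqint_class; split => //; apply/integrableP; split.
    by apply/measurable_EFinP; exact: measurable_sqrc.
  under eq_integral do rewrite gee0_abs ?lee_fin ?sqrc_ge0//.
  exact: (le_lt_trans (iw 0%N) (ltry _)).
have h0 : h = 0.
  apply: L2sq_eq0; apply/le_anti; rewrite L2sq_ge0 andbT.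
  by apply: (@geometric_le0 R _ K) => m; rewrite -lee_fin (L2sqE mw hE).
rewrite h0 in hE; apply: filterS2 hE (L2_fun0 R) => t -> /eqP.
by rewrite subr_eq0 => /eqP.
Qed.

(** On the indicator f of the set where |r|^2 > K + 1, the bound of Y reads
    (K + 1) |f|^2 <= |r f|^2 <= K |f|^2, so that set is negligible. *)
Lemma commuting_symbol_bounded : \forall t \ae mu, sqrc (r t) <= K + 1.
Proof.
have mr : cmeas r by exact: L2_cmeas.
pose A : set R := [set t | K + 1 < sqrc (r t)].
have mA : measurable (A : set Rm).
  have := measurable_sqrc mr measurableT (measurable_itv `]K + 1, +oo[).
  rewrite setTI; congr measurable; apply/seteqP; split => t; rewrite /A /= in_itv /= andbT//.
have [f fE] : exists f : L2, \forall t \ae mu, cLp_fun f t = (\1_A t)%:C.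
  have m1 : measurable_fun [set: Rm] (\1_A : R -> R) by exact: measurable_indic.
  apply: sqint_class; split.
    by split => //; exact: measurable_cst.
  apply: (@le_integrable _ Rm R mu setT measurableT _ (EFin \o cst 1)).
  - apply/measurable_EFinP; apply: measurable_sqrc.
    by split => //; exact: measurable_cst.
  - move=> t _ /=; rewrite lee_fin /sqrc /= expr0n addr0 ger0_norm ?sqr_ge0//.
    by rewrite indicE normr1; case: (t \in A); rewrite ?expr1n ?expr0n.
  - exact: finite_measure_integrable_cst.
have f0 : f = 0.
  apply: L2sq_eq0; apply/le_anti; rewrite L2sq_ge0 andbT.
  have K1 : 0 < K + 1 by rewrite ltr_wpDl.
  have : L2sq f <= (K + 1)^-1 * L2sq (Y f).
    apply: L2sq_le; first by rewrite invr_ge0 ltW.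
    apply: filterS2 fE (commuting_pointwise f) => t E ->; rewrite E sqrcM.
    rewrite indicE; case: (boolP (t \in A)) => tA.
      rewrite [X in X <= _](_ : _ = 1); last by rewrite /sqrc /= expr1n expr0n addr0.
      rewrite [X in _ * (_ * X)](_ : _ = 1); last by rewrite /sqrc /= expr1n expr0n addr0.
      rewrite mulr1 mulrC ler_pdivlMr// mul1r ltW//.
      by rewrite inE in tA.
    by rewrite /sqrc /= !expr0n /= addr0 mulr0 mulr0.
  have := YK f; have := L2sq_ge0 f.
  rewrite [(K + 1)^-1 * _]mulrC ler_pdivlMr//; lra.
rewrite f0 in fE; apply: filterS2 fE (L2_fun0 R) => t -> /eqP.
rewrite indicE; case: (boolP (t \in A)) => [_|tA _].
  by rewrite eq_complex /= oner_eq0.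
by rewrite leNgt; apply: contra tA => h; rewrite inE.
Qed.

Lemma commutant_multiplication : exists rho : Loo, forall f, Y f = mulop rho f.
Proof.
have [rho rhoE] : exists rho : Loo, \forall t \ae mu, cLp_fun rho t = r t.
  apply: (@Linf_exists _ _ (Num.sqrt (K + 1))); first exact: L2_cmeas.
  apply: filterS commuting_symbol_bounded => t h.
  by rewrite normc_def2 ler_sqrt//; apply: (le_trans (sqrc_ge0 _) h).
exists rho => f; apply: L2_ext.
by apply: filterS3 (commuting_pointwise f) (mulopE rho f) rhoE => t -> -> ->.
Qed.

End CommutingOperator.
End Commutant.

(** * Orthogonality of the Fourier modes *)

Section FourierModes.
Variable R : realType.
Local Notation mu := (@circle_measure R).
Local Notation Rm := (measurableTypeR R).
Local Notation Re := complex.Re.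
Local Notation Im := complex.Im.

(** The derivative of a function taking equal values at 0 and 1 has mean 0;
    this is used for the orthogonality of the modes z^m. *)
Lemma circle_integral_derivative (F f : R -> R) :
  (forall x : R, is_derive x 1 F (f x)) -> continuous f -> F 0 = F 1 ->
  \int[mu]_t f t = 0.
Proof.
move=> dF cf F01.
have mf : measurable_fun [set: Rm] f by exact: continuous_measurable_fun.
pose D : set R := `[0, 1[%classic.
have mD : measurable (D : set Rm) by exact: measurable_itv.
have cF : continuous F.
  by move=> x; apply/differentiable_continuous/derivable1_diffP; have [] := dF x.
have e : (\int[mu]_(t in D) (f t)%:E = 0)%E.
  rewrite circle_integralE// /D integral_itv_bndo_bndc; last first.
    by apply/measurable_EFinP; apply: measurable_funTS.
  rewrite (@continuous_FTC2 _ f F)//.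
  - by rewrite F01 subee.
  - exact: continuous_subspaceT.
  - split; first by move=> x _; have [] := dF x.
      exact/cvg_at_right_filter/cF.
    exact/cvg_at_left_filter/cF.
  - by move=> x _; rewrite derive1E; apply: derive_val.
rewrite /Rintegral (_ : (\int[mu]_t (f t)%:E)%E = 0%E)// -e.
rewrite [in RHS]integral_mkcond; apply: ae_eq_integral => //.
- exact/measurable_EFinP.
- apply/(measurable_restrictT _ mD); apply/measurable_EFinP.
  by apply: measurable_funTS.
- by apply: filterS (ae_mem_itv R) => t t01 _; rewrite /patch /D mem_setE t01.
Qed.

Lemma circle_ptX (t : R) m :
  circle_pt t ^+ m = cos (2 * trigo.pi * m%:R * t) +i* sin (2 * trigo.pi * m%:R * t).
Proof.
elim: m => [|m IH]; first by rewrite expr0 mulr0 mul0r cos0 sin0.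
rewrite exprS IH /circle_pt -[m.+1%:R]natr1.
rewrite (_ : 2 * trigo.pi * (m%:R + 1) * t =
   2 * trigo.pi * t + 2 * trigo.pi * m%:R * t); last by ring.
rewrite cosD sinD; apply/eqP; rewrite eq_complex /=.
by apply/andP; split; apply/eqP => //; ring.
Qed.

Lemma circle_pt1 : circle_pt (1 : R) = 1.
Proof.
rewrite /circle_pt mulr1 (_ : 2 * trigo.pi = 0 + trigo.pi *+ 2 :> R).
  by rewrite cosD2pi sinD2pi cos0 sin0.
by rewrite add0r mulr_natl.
Qed.

Lemma is_derive_sinZ (w x : R) : w != 0 ->
  is_derive x 1 (fun t => w^-1 * sin (w * t)) (cos (w * x)).
Proof.
move=> w0.
have d : is_derive x 1 (sin \o ( *%R w)) (cos (w * x) * w).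
  by apply: is_derive1_comp; apply: is_derive_eq; rewrite ?scaler1.
have h := @is_deriveZ _ _ _ _ w^-1 x 1 _ d.
rewrite (_ : cos (w * x) = w^-1 *: (cos (w * x) * w))//.
by rewrite /GRing.scale /= mulrCA mulVf ?mulr1.
Qed.

Lemma is_derive_cosZ (w x : R) : w != 0 ->
  is_derive x 1 (fun t => - w^-1 * cos (w * t)) (sin (w * x)).
Proof.
move=> w0.
have d : is_derive x 1 (cos \o ( *%R w)) (- sin (w * x) * w).
  by apply: is_derive1_comp; apply: is_derive_eq; rewrite ?scaler1.
have h := @is_deriveZ _ _ _ _ (- w^-1) x 1 _ d.
rewrite (_ : sin (w * x) = (- w^-1) *: (- sin (w * x) * w))//.
by rewrite /GRing.scale /=; field.
Qed.

Lemma fourier_mode_integral m : cintegral (fun t : R => circle_pt t ^+ m.+1) = 0.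
Proof.
pose w : R := 2 * trigo.pi * m.+1%:R.
have w0 : w != 0 by rewrite !mulf_neq0// gt_eqF ?pi_gt0.
have := circle_ptX 1 m.+1; rewrite circle_pt1 expr1n -/w => -[c1 s1].
have cl : continuous ( *%R w) by move=> t; exact: mulrl_continuous.
have eR : (fun t : R => Re (circle_pt t ^+ m.+1)) = fun t => cos (w * t).
  by apply/funext => t; rewrite circle_ptX.
have eI : (fun t : R => Im (circle_pt t ^+ m.+1)) = fun t => sin (w * t).
  by apply/funext => t; rewrite circle_ptX.
rewrite /cintegral eR eI.
have -> : \int[mu]_t cos (w * t) = 0.
  apply: (@circle_integral_derivative (fun t => w^-1 * sin (w * t)) (fun t => cos (w * t))).
  - by move=> x; exact: is_derive_sinZ.
  - by move=> t; apply: continuous_comp; [exact: cl|exact: continuous_cos].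
  - by rewrite -s1 mulr0 sin0.
have -> : \int[mu]_t sin (w * t) = 0.
  apply: (@circle_integral_derivative (fun t => - w^-1 * cos (w * t)) (fun t => sin (w * t))).
  - by move=> x; exact: is_derive_cosZ.
  - by move=> t; apply: continuous_comp; [exact: cl|exact: continuous_sin].
  - by rewrite -c1 mulr0 cos0.
by [].
Qed.

End FourierModes.

(** * The Hardy space *)

Section HardySpace.
Variable R : realType.
Local Notation mu := (@circle_measure R).
Local Notation Rm := (measurableTypeR R).
Local Notation normc := (@Normc.normc R).
Local Notation cmeas := (@cmeasurable _ Rm R).
Local Notation Re := complex.Re.
Local Notation Im := complex.Im.
Local Notation L2 := (L2T R).

(** The mode z^-m: H^2 is the orthogonal of those with m > 0. *)
Definition neg_mode m : L2 := iter m (mulop (zbar_T R)) (one_T R).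

Lemma neg_modeE m : \forall t \ae mu, cLp_fun (neg_mode m) t = conjc (circle_pt t) ^+ m.
Proof.
elim: m => [|m IH]; first exact: one_TE.
apply: filterS3 (mulopE (zbar_T R) (neg_mode m)) (zbar_TE R) IH => t.
by move=> -> -> ->; rewrite exprS.
Qed.

Lemma cmeasurable_circle_ptX m : cmeas (fun t => circle_pt t ^+ m).
Proof. by have [] := trig_multiplierX m (trig_multiplier_z R). Qed.

Lemma inner_neg_mode (f : L2) m :
  inner f (neg_mode m) = cintegral (fun t => cLp_fun f t * circle_pt t ^+ m).
Proof.
apply: eq_ae_cintegral.
- by apply: cmeasurableM; [|apply: cmeasurable_conj]; exact: L2_cmeas.
- by apply: cmeasurableM; [exact: L2_cmeas|exact: cmeasurable_circle_ptX].
- by apply: filterS (neg_modeE m) => t ->; rewrite conjcX conjcK.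
Qed.

Lemma H2P (f : L2) : H2 f <-> forall m, inner f (neg_mode m.+1) = 0.
Proof.
split=> [hf m|hf [//|m] _]; rewrite ?inner_neg_mode.
  exact: (hf (Negz m)).
by have := hf m; rewrite inner_neg_mode.
Qed.

Lemma z_neg_mode m : mulop (z_T R) (neg_mode m.+1) = neg_mode m.
Proof. by rewrite /= zbarK. Qed.

Lemma inner_one : inner (one_T R) (one_T R) = 1.
Proof.
rewrite -[X in inner _ X]/(neg_mode 0) inner_neg_mode.
transitivity (cintegral (fun _ : R => 1 : R[i])).
  apply: eq_ae_cintegral.
  - by apply: cmeasurableM; [exact: L2_cmeas|exact: cmeasurable_circle_ptX].
  - exact: (cmeasurable_cst Rm 1).
  - by apply: filterS (one_TE R) => t ->; rewrite mul1r.
rewrite /cintegral /= !Rintegral_cst//= probability_setT mul0r mulr1//.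
Qed.

Lemma H2_one : H2 (one_T R).
Proof.
apply/H2P => m; rewrite inner_neg_mode -(fourier_mode_integral R m).
apply: eq_ae_cintegral.
- by apply: cmeasurableM; [exact: L2_cmeas|exact: cmeasurable_circle_ptX].
- exact: cmeasurable_circle_ptX.
- by apply: filterS (one_TE R) => t ->; rewrite mul1r.
Qed.

Lemma H2_lin c (f g : L2) : H2 f -> H2 g -> H2 (c *: f + g).
Proof.
by move=> /H2P hf /H2P hg; apply/H2P => m; rewrite inner_lin hf hg mulr0 addr0.
Qed.

Lemma H2_0 : H2 (0 : L2).
Proof. by apply/H2P => m; rewrite inner0l. Qed.

Lemma H2B (f g : L2) : H2 f -> H2 g -> H2 (f - g).
Proof. by move=> hf hg; rewrite addrC -scaleN1r; exact: H2_lin. Qed.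

Lemma H2Z c (f : L2) : H2 f -> H2 (c *: f).
Proof. by move=> hf; rewrite -[_ *: _]addr0; apply: H2_lin => //; exact: H2_0. Qed.

Lemma H2D (f g : L2) : H2 f -> H2 g -> H2 (f + g).
Proof. by move=> hf hg; rewrite -[f]scale1r; exact: H2_lin. Qed.

Lemma H2_z (f : L2) : H2 f -> H2 (mulop (z_T R) f).
Proof. by move=> /H2P hf; apply/H2P => m; rewrite inner_z -[mulop _ _]/(neg_mode m.+2). Qed.

(** H^2 is the direct sum of the constants and of z H^2: this codimension one
    is the source of the rank-one commutators. *)
Lemma H2_shift_decomposition (f : L2) : H2 f ->
  exists2 g, H2 g & f = inner f (one_T R) *: one_T R + mulop (z_T R) g.
Proof.
move=> hf; exists (mulop (zbar_T R) (f - inner f (one_T R) *: one_T R)); last first.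
  by rewrite zbarK addrC subrK.
apply/H2P => m; rewrite inner_zbar z_neg_mode.
case: m => [|m].
  by rewrite /= innerBl innerZl inner_one mulr1 subrr.
by have /H2P -> := H2B hf (H2Z (inner f (one_T R)) H2_one).
Qed.

(** H^2 is closed, since by [H2P] it is an intersection of kernels of inner
    products: the best approximation of f in H^2 belongs to H^2. *)
Lemma H2_projection (f : L2) : exists2 p, H2 p & orthocomp (@H2 R) (f - p).
Proof.
have [s [p [hs _ ds fp]]] := L2_best_approximation f H2_0 H2_lin.
exists p => //; apply/H2P => m.
apply: sqrc_eq0; apply/le_anti; rewrite sqrc_ge0 andbT.
apply: (@geometric_le0 R _ (L2sq (neg_mode m.+1))) => k.
have /H2P hk := hs k.
rewrite -[inner p _]subr0 -(hk m) -innerBl mulrC.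
apply: (le_trans (L2sq_Schwarz _ _)); apply: ler_wpM2r => //; exact: L2sq_ge0.
Qed.

Lemma complex_cvg_dist {T} {F : set_system T} {FF : Filter F} (u : T -> R[i]) (l : R[i]) :
  (u : T -> R[i]^o) @ F --> (l : R[i]^o) ->
  forall e : R, 0 < e -> \forall x \near F, normc (l - u x) < e.
Proof.
move=> /cvgrPdist_lt h e e0; have := h e%:C; rewrite ltcR => /(_ e0).
by apply: filterS => x; rewrite -ltcR.
Qed.

Lemma complex_cvg_parts {T} {F : set_system T} {FF : Filter F} (u : T -> R[i]) (l : R[i]) :
  (forall e : R, 0 < e -> \forall x \near F, normc (l - u x) < e) ->
  (fun x => Re (u x)) @ F --> Re l /\ (fun x => Im (u x)) @ F --> Im l.
Proof.
move=> h; split; apply/cvgrPdist_lt => e e0; apply: filterS (h e e0) => x;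
  apply: le_lt_trans.
  by rewrite (_ : Re l - Re (u x) = Re (l - u x)) ?normc_Re//; case: l (u x) {h} => ? ? [].
by rewrite (_ : Im l - Im (u x) = Im (l - u x)) ?normc_Im//; case: l (u x) {h} => ? ? [].
Qed.

End HardySpace.

(** * Multiplication by boundary values of bounded analytic functions *)

Section AnalyticMultipliers.
Variable R : realType.
Local Notation Rm := (measurableTypeR R).
Local Notation normc := (@Normc.normc R).
Local Notation cmeas := (@cmeasurable _ Rm R).
Local Notation Re := complex.Re.
Local Notation Im := complex.Im.
Local Notation L2 := (L2T R).
Local Notation Loo := (LinfT R).

Lemma normc_circle_ptX (t : R) m : normc (circle_pt t ^+ m) = 1.
Proof.
elim: m => [|m IH]; first by rewrite expr0 Normc.normc1.
by rewrite exprS Normc.normcM IH circle_pt_normc mulr1.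
Qed.

Lemma normc_real (r : R) : 0 <= r -> normc r%:C = r.
Proof. by move=> r0; rewrite normc_def2 /= expr0n addr0 sqrtr_sqr ger0_norm. Qed.

Lemma normc_radius (r t : R) : 0 <= r -> normc (r%:C * circle_pt t) = r.
Proof. by move=> r0; rewrite Normc.normcM circle_pt_normc mulr1 normc_real. Qed.

Lemma unit_disk_radius (r t : R) : 0 <= r < 1 -> unit_disk (r%:C * circle_pt t).
Proof.
move=> /andP[r0 r1]; rewrite /unit_disk /=.
by rewrite -[X in X < _]/((normc (r%:C * circle_pt t))%:C) normc_radius// ltcR.
Qed.

Lemma normcX (w : R[i]) n : normc (w ^+ n) = normc w ^+ n.
Proof.
elim: n => [|n IH]; first by rewrite !expr0 Normc.normc1.
by rewrite !exprS Normc.normcM IH.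
Qed.

Lemma normc_sum n (x : nat -> R[i]) : normc (\sum_(0 <= j < n) x j) <= \sum_(j < n) normc (x j).
Proof.
elim: n => [|n IH]; first by rewrite big_geq// big_ord0 Normc.normc0.
rewrite big_nat_recr//= big_ord_recr /=.
by apply: (le_trans (le_normcD _ _)); rewrite lerD2r.
Qed.

(** The terms are bounded at the larger radius s, hence dominated by a
    geometric series of ratio r / s on the circle of radius r. *)
Lemma power_series_bounded (c : nat -> R[i]) (s r : R) (l : R[i]) : 0 <= r < s ->
  ([series c n * s%:C ^+ n]_n : nat -> R[i]^o) @ \oo --> (l : R[i]^o) ->
  exists M, forall n w, normc w = r -> normc (\sum_(0 <= j < n) c j * w ^+ j) <= M.
Proof.
move=> /andP[r0 rs] cl.
have s0 : 0 < s by exact: le_lt_trans rs.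
have [N _ hN] := complex_cvg_dist cl ltr01.
pose a j := normc (c j * s%:C ^+ j).
have tail j : (N <= j)%N -> a j <= 2.
  move=> Nj; have h1 := hN j Nj; have h2 := hN j.+1 (leqW Nj).
  have -> : a j = normc ((l - \sum_(0 <= k < j) c k * s%:C ^+ k) +
       - (l - \sum_(0 <= k < j.+1) c k * s%:C ^+ k)).
    by rewrite big_nat_recr//= /a; congr normc; ring.
  apply: (le_trans (le_normcD _ _)); rewrite normcN.
  by rewrite (_ : 2 = 1 + 1 :> R)// lerD// ltW.
(* The terms of rank below N are at most their sum, and the others at most 2. *)
pose M0 := \sum_(j < N) a j + 2.
have a0 j : 0 <= a j by exact: normc_ge0.
have aM j : a j <= M0.
  have [jN|Nj] := ltnP j N; last first.
    by apply: (le_trans (tail _ Nj)); rewrite lerDr sumr_ge0.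
  rewrite /M0 (bigD1 (Ordinal jN))//= -addrA lerDl addr_ge0// sumr_ge0//.
pose q := r / s.
have q0 : 0 <= q by rewrite divr_ge0// ltW.
have q1 : q < 1 by rewrite ltr_pdivrMr// mul1r.
exists (M0 * (1 - q)^-1) => n w wr.
apply: (le_trans (normc_sum _ _)).
apply: (@le_trans _ _ (M0 * \sum_(j < n) q ^+ j)).
  rewrite mulr_sumr; apply: ler_sum => j _.
  have -> : normc (c j * w ^+ j) = a j * q ^+ j.
    rewrite /a !Normc.normcM !normcX wr normc_real ?(ltW s0)// /q expr_div_n.
    by rewrite -mulrA [s ^+ j * _]mulrC divfK// gt_eqF// exprn_gt0.
  by apply: ler_wpM2r; [exact: exprn_ge0|exact: aM].
apply: ler_wpM2l; first by rewrite (le_trans (a0 0%N)).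
rewrite -[leRHS]mul1r ler_pdivlMr ?subr_gt0//.
have -> : (\sum_(j < n) q ^+ j) * (1 - q) = 1 - q ^+ n.
  elim: n => [|n IH]; first by rewrite big_ord0 mul0r expr0 subrr.
  by rewrite big_ord_recr /= mulrDl IH exprS; ring.
by rewrite gerBl exprn_ge0.
Qed.

Lemma cvg_mulr_parts (x : nat -> R[i]) (l g : R[i]) :
  (fun n => Re (x n)) @ \oo --> Re l /\ (fun n => Im (x n)) @ \oo --> Im l ->
  (fun n => Re (x n * g)) @ \oo --> Re (l * g) /\
  (fun n => Im (x n * g)) @ \oo --> Im (l * g).
Proof.
move=> [cr ci]; split.
  rewrite cReM (_ : (fun n => _) = fun n => Re (x n) * Re g - Im (x n) * Im g).
    by apply: cvgB; apply: cvgM => //; exact: cvg_cst.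
  by apply/funext => n; rewrite cReM.
rewrite cImM (_ : (fun n => _) = fun n => Re (x n) * Im g + Im (x n) * Re g).
  by apply: cvgD; apply: cvgM => //; exact: cvg_cst.
by apply/funext => n; rewrite cImM.
Qed.

Lemma H2_mode_integral (f : L2) m : H2 f ->
  cintegral (fun t => cLp_fun f t * circle_pt t ^+ m.+1) = 0.
Proof. by move=> /H2P hf; rewrite -inner_neg_mode. Qed.

Lemma L2_mode_integrable (f : L2) m :
  cintegrable (fun t => cLp_fun f t * circle_pt t ^+ m).
Proof.
have [k ik kP] := normc_bound_integrable f ler01.
apply: (cintegrable_le _ _ ik).
  by apply: cmeasurableM; [exact: L2_cmeas|exact: cmeasurable_circle_ptX].
by move=> t; rewrite Normc.normcM normc_circle_ptX mulr1 -[leLHS]mul1r.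
Qed.

Section Dilation.
Variables (F : R[i] -> R[i]) (hF : analytic_on_disk F) (r : R) (r01 : 0 <= r < 1).

Let Fr t := F (r%:C * circle_pt t).

(** On the circle of radius r < 1 the power series converges boundedly, and
    multiplying f by a polynomial in z only involves its modes z^-(m+1),
    z^-(m+2), ..., all of which are orthogonal to f. *)
Lemma dilation_integral (f : L2) m : H2 f ->
  cmeas Fr /\
  cintegral (fun t => Fr t * (cLp_fun f t * circle_pt t ^+ m.+1)) = 0.
Proof.
move=> hf; have [c hc] := hF.
pose S N t : R[i] := \sum_(0 <= j < N) c j * (r%:C * circle_pt t) ^+ j.
pose g t := cLp_fun f t * circle_pt t ^+ m.+1.
have tS N : trig_multiplier (S N).
  elim: N => [|N IH].
    rewrite (_ : S 0%N = fun=> 0); first exact: trig_multiplier_cst.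
    by apply/funext => t; rewrite /S big_geq.
  rewrite (_ : S N.+1 = fun t => S N t + c N * (r%:C * circle_pt t) ^+ N); last first.
    by apply/funext => t; rewrite /S big_nat_recr.
  apply: trig_multiplierD => //; apply: trig_multiplierM.
    exact: trig_multiplier_cst.
  apply: trig_multiplierX; apply: trig_multiplierM; first exact: trig_multiplier_cst.
  exact: trig_multiplier_z.
have cS t : (fun N => Re (S N t)) @ \oo --> Re (Fr t) /\
            (fun N => Im (S N t)) @ \oo --> Im (Fr t).
  apply: complex_cvg_parts; apply: complex_cvg_dist.
  exact: hc (unit_disk_radius t r01).
have mF : cmeas Fr.
  split.
    by apply: (@measurable_fun_cvg _ Rm R setT (fun N t => Re (S N t))) => [N|t _];
      [have [[]] := tS N|have [] := cS t].
  by apply: (@measurable_fun_cvg _ Rm R setT (fun N t => Im (S N t))) => [N|t _];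
    [have [[]] := tS N|have [] := cS t].
split=> //.
have mg : cmeas g.
  by apply: cmeasurableM; [exact: L2_cmeas|exact: cmeasurable_circle_ptX].
have [M hM] : exists M, forall N t, normc (S N t) <= M.
  move: (r01) => /andP[r0 r1].
  (* The series is used at a radius strictly between r and 1. *)
  have s1 : 0 <= (1 + r) / 2 < 1 by apply/andP; split; lra.
  have sr : 0 <= r < (1 + r) / 2 by apply/andP; split; lra.
  have sd : unit_disk ((1 + r) / 2)%:C.
    have := unit_disk_radius 1 s1; by rewrite circle_pt1 mulr1.
  have [M MP] := power_series_bounded sr (hc _ sd).
  by exists M => N t; apply: MP; exact: normc_radius.
have M0 : 0 <= M by apply: le_trans (hM 0%N 0); exact: normc_ge0.
have [k ik kP] := normc_bound_integrable f M0.
apply: (@cintegral_limit0 R (fun N t => S N t * g t) _ k) => //.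
- by move=> N; apply: cmeasurableM => //; have [] := tS N.
- exact: cmeasurableM.
- by apply: aeW => t; exact: cvg_mulr_parts.
- move=> N t; apply: le_trans (kP t).
  rewrite !Normc.normcM normc_circle_ptX mulr1.
  by apply: ler_wpM2r; [exact: normc_ge0|exact: hM].
- suff H N : cintegrable (fun t => S N t * g t) /\ cintegral (fun t => S N t * g t) = 0.
    by move=> N; have [] := H N.
  elim: N => [|N [iN eN]].
    rewrite (_ : (fun t => _) = fun t => 0 * g t); last first.
      by apply/funext => t; rewrite /S big_geq.
    split; first by apply: cintegrableZ; exact: L2_mode_integrable.
    by rewrite cintegralZ ?mul0r//; exact: L2_mode_integrable.
  rewrite (_ : (fun t => _) = fun t => S N t * g t +
     (c N * r%:C ^+ N) * (cLp_fun f t * circle_pt t ^+ (m + N).+1)); last first.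
    apply/funext => t; rewrite /S big_nat_recr//= mulrDl exprMn /g -addSn exprD.
    by ring.
  have i2 := cintegrableZ (c N * r%:C ^+ N) (L2_mode_integrable f (m + N).+1).
  split; first exact: cintegrableD.
  rewrite cintegralD// eN cintegralZ; last exact: L2_mode_integrable.
  by rewrite H2_mode_integral// mulr0 addr0.
Qed.

End Dilation.

(** The boundary function is the limit of the dilations F (r z) as r tends to
    1, and these are uniformly bounded. In particular theta H^2 is contained in
    H^2. *)
Lemma H2_analytic_multiplier (F : R[i] -> R[i]) (u : Loo) (f : L2) :
  analytic_on_disk F -> bounded_on_disk F -> boundary_values F u ->
  H2 f -> H2 (mulop u f).
Proof.
move=> aF [K bF] bv hf; apply/H2P => m; rewrite inner_neg_mode.
have K0 : 0 <= K.
  apply: (le_trans (normc_ge0 (F 0))); apply: bF.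
  by rewrite /unit_disk /= normr0 ltr01.
pose r n : R := 1 - n.+1%:R^-1.
have r01 n : 0 <= r n < 1.
  rewrite /r subr_ge0 invf_le1 ?ler1n//= gtrBl invr_gt0//.
pose g t := cLp_fun f t * circle_pt t ^+ m.+1.
have mg : cmeas g.
  by apply: cmeasurableM; [exact: L2_cmeas|exact: cmeasurable_circle_ptX].
have [k ik kP] := normc_bound_integrable f K0.
transitivity (cintegral (fun t => cLp_fun u t * g t)).
  apply: eq_ae_cintegral.
  - by apply: cmeasurableM; [exact: L2_cmeas|exact: cmeasurable_circle_ptX].
  - by apply: cmeasurableM => //; exact: Linf_cmeas.
  - by apply: filterS (mulopE u f) => t ->; rewrite mulrA.
have cr : r @ \oo --> (1 : R).
  by rewrite -[X in _ --> X]subr0; apply: cvgB; [exact: cvg_cst|exact: cvg_harmonic].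
have crl : r @ \oo --> 1^'-.
  move=> P Pn; have := cr _ Pn; rewrite /= !nbhs_simpl /=.
  by apply: filterS => n; apply; have /andP[] := r01 n.
apply: (@cintegral_limit0 R (fun n t => F ((r n)%:C * circle_pt t) * g t) _ k) => //.
- move=> n; apply: cmeasurableM => //.
  by have [] := dilation_integral aF (r01 n) 0 hf.
- by apply: cmeasurableM => //; exact: Linf_cmeas.
- apply: filterS bv => t bt; apply: cvg_mulr_parts; apply: complex_cvg_parts => e e0.
  have H := complex_cvg_dist bt e0; exact: (crl _ (H _)).
- move=> n t; apply: le_trans (kP t).
  rewrite !Normc.normcM normc_circle_ptX mulr1.
  apply: ler_wpM2r; first exact: normc_ge0.
  by apply: bF; exact: unit_disk_radius.
- by move=> n; have [] := dilation_integral aF (r01 n) m hf.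
Qed.

End AnalyticMultipliers.

(** * The three projections and their commutators with M_z *)

Section Projections.
Variable R : realType.
Local Notation mu := (@circle_measure R).
Local Notation L2 := (L2T R).
Local Notation Loo := (LinfT R).

Lemma subr_cancel (f g p : L2) : (f - g) - (f - p) = p - g.
Proof. by rewrite opprB [LHS]addrC addrA subrK. Qed.

(** Two candidates for the projection differ by an element of S orthogonal to
    S, which is therefore 0. *)
Lemma orthoproj_eq (S : set L2) (f g : L2) :
  (forall u v, S u -> S v -> S (u - v)) -> S g -> orthocomp S (f - g) ->
  orthoproj S f = g.
Proof.
move=> SB Sg fg; rewrite /orthoproj.
have [Sp fp] := @xgetPex _ 0 [set g | S g /\ orthocomp S (f - g)]
  (ex_intro _ g (conj Sg fg)).
set p := xget _ _ in Sp fp *.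
apply: subr0_eq; apply: L2sq_eq0; apply: complexI; rewrite -L2sq_inner.
have Spg : S (p - g) by exact: SB.
by rewrite -{1}(subr_cancel f) innerBl fg// fp// subrr.
Qed.

Lemma orthocompB (S : set L2) (u v : L2) :
  orthocomp S u -> orthocomp S v -> orthocomp S (u - v).
Proof. by move=> hu hv h Sh; rewrite innerBl hu// hv// subrr. Qed.

Definition hardy_proj (f : L2) : L2 := orthoproj (@H2 R) f.

Lemma hardy_projP (f : L2) :
  H2 (hardy_proj f) /\ orthocomp (@H2 R) (f - hardy_proj f).
Proof.
have [p hp fp] := H2_projection f.
by rewrite /hardy_proj (orthoproj_eq (@H2B R) hp fp).
Qed.

Lemma hardy_proj_eq (f p : L2) : H2 p -> orthocomp (@H2 R) (f - p) -> hardy_proj f = p.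
Proof. exact: (orthoproj_eq (@H2B R)). Qed.

Lemma hardy_proj_lin c (f g : L2) :
  hardy_proj (c *: f + g) = c *: hardy_proj f + hardy_proj g.
Proof.
have [hf of_] := hardy_projP f; have [hg og] := hardy_projP g.
apply: hardy_proj_eq; first exact: H2_lin.
move=> h hh; rewrite opprD addrACA -scalerBr inner_lin.
by rewrite of_// og// mulr0 addr0.
Qed.

Lemma L2sq_Pythagoras (f g : L2) : inner f g = 0 -> L2sq (f + g) = L2sq f + L2sq g.
Proof.
move=> fg; apply: complexI; rewrite rmorphD /= -!L2sq_inner.
by rewrite innerDl !innerDr (inner_conj f g) fg conjc0 addr0 add0r.
Qed.

Lemma hardy_proj_contraction (f : L2) : L2sq (hardy_proj f) <= L2sq f.
Proof.
have [hf of_] := hardy_projP f.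
rewrite -[in leRHS](subrK (hardy_proj f) f) L2sq_Pythagoras; last exact: of_.
by rewrite lerDr L2sq_ge0.
Qed.

(** The commutator of the projection on H^2 with M_z is the rank-one operator
    with range the constants. For h = c + z g in H^2 the vector z (f - P f) is
    orthogonal to z g, and its product with c only sees the coefficient of
    index -1 of f. *)
Lemma hardy_proj_z (f : L2) : hardy_proj (mulop (z_T R) f) =
  mulop (z_T R) (hardy_proj f) + inner f (toL2 (zbar_T R)) *: one_T R.
Proof.
have [hf of_] := hardy_projP f; set p := hardy_proj f in hf of_ *.
set a := inner f _.
have ap : inner (f - p) (toL2 (zbar_T R)) = a.
  by rewrite innerBl; have /H2P/(_ 0%N) := hf; rewrite /= -/(toL2 _) => ->; rewrite subr0.
apply: hardy_proj_eq.
  by apply: H2D; [exact: H2_z|apply: H2Z; exact: H2_one].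
move=> h hh; rewrite opprD addrA -mulopBr innerBl innerZl inner_z.
have [g hg {1}->] := H2_shift_decomposition hh.
rewrite mulopDr mulopZ zK innerDr innerZr (of_ g hg) addr0 ap.
by rewrite (inner_conj h) mulrC subrr.
Qed.

Section InnerFunction.
Variables (theta thetac : Loo).
Hypothesis thetacE : \forall t \ae mu, cLp_fun thetac t = conjc (cLp_fun theta t).
Hypothesis theta_unimodular : \forall t \ae mu, `|cLp_fun theta t| = 1.
Hypothesis theta_H2 : forall f, H2 f -> H2 (mulop theta f).

Lemma theta_thetac t : `|cLp_fun theta t| = 1 ->
  cLp_fun theta t * conjc (cLp_fun theta t) = 1.
Proof. by rewrite -sqr_normc => ->; rewrite expr1n. Qed.

Lemma thetacK (f : L2) : mulop thetac (mulop theta f) = f.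
Proof.
apply: mulop_cancel; apply: filterS2 thetacE theta_unimodular => t -> h.
by rewrite mulrC theta_thetac.
Qed.

Lemma inner_theta (f g : L2) : inner f (mulop theta g) = inner (mulop thetac f) g.
Proof.
by apply/esym/inner_mulop; apply: filterS thetacE => t ->; rewrite conjcK.
Qed.

(** M_theta is unitary, so the projection on theta H^2 is the conjugate by
    M_theta of the projection on H^2. *)
Definition theta_proj (f : L2) : L2 := mulop theta (hardy_proj (mulop thetac f)).

Lemma thetaH2B (u v : L2) : thetaH2 theta u -> thetaH2 theta v -> thetaH2 theta (u - v).
Proof.
by move=> [f hf <-] [g hg <-]; exists (f - g); [exact: H2B|rewrite mulopBr].
Qed.

Lemma theta_projP (f : L2) :
  thetaH2 theta (theta_proj f) /\ orthocomp (thetaH2 theta) (f - theta_proj f).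
Proof.
have [hp op] := hardy_projP (mulop thetac f).
split; first by exists (hardy_proj (mulop thetac f)).
by move=> _ [h hh <-]; rewrite inner_theta mulopBr thetacK op.
Qed.

Lemma orthoproj_thetaH2 (f : L2) : orthoproj (thetaH2 theta) f = theta_proj f.
Proof. by have [tp op] := theta_projP f; exact: orthoproj_eq thetaH2B tp op. Qed.

Lemma sub_thetaH2_H2 (f : L2) : thetaH2 theta f -> H2 f.
Proof. by move=> [g hg <-]; exact: theta_H2. Qed.

(** The inclusion of theta H^2 in H^2 is what makes this difference a
    projection. *)
Lemma orthoproj_model_space (f : L2) :
  orthoproj (model_space theta) f = hardy_proj f - theta_proj f.
Proof.
have [hp op] := hardy_projP f; have [tp otp] := theta_projP f.
apply: orthoproj_eq.
- by move=> u v [hu ou] [hv ov]; split; [exact: H2B|exact: orthocompB].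
- split; first by apply: H2B => //; exact: sub_thetaH2_H2.
  rewrite -(subr_cancel f).
  by apply: orthocompB => // h /sub_thetaH2_H2; exact: op.
- move=> h [hh oh]; rewrite opprB addrCA addrC innerDl (op h hh) add0r.
  by rewrite inner_conj oh// conjc0.
Qed.

Lemma orthoproj_H2minus (f : L2) : orthoproj (@H2minus R) f = f - hardy_proj f.
Proof.
have [hp op] := hardy_projP f.
apply: orthoproj_eq => //; first exact: orthocompB.
by move=> h oh; rewrite opprB addrC subrK inner_conj oh// conjc0.
Qed.

Lemma theta_proj_z (f : L2) : theta_proj (mulop (z_T R) f) =
  mulop (z_T R) (theta_proj f) +
  inner f (mulop (zbar_T R) (toL2 theta)) *: toL2 theta.
Proof.
rewrite /theta_proj mulopC hardy_proj_z mulopDr mulopZ mulopC.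
by rewrite -inner_theta [mulop theta (toL2 _)]mulopC.
Qed.

Lemma theta_proj_lin c (f g : L2) :
  theta_proj (c *: f + g) = c *: theta_proj f + theta_proj g.
Proof. by rewrite /theta_proj mulop_lin hardy_proj_lin mulop_lin. Qed.

Section Symbols.
Variables a b : Loo.

(** The operator of the statement for the symbol rho = 0. *)
Definition model_op (f : L2) : L2 := mulop a (theta_proj f) + mulop b (hardy_proj f).

Lemma model_op_lin c (f g : L2) : model_op (c *: f + g) = c *: model_op f + model_op g.
Proof.
by rewrite /model_op theta_proj_lin hardy_proj_lin !mulop_lin scalerDr addrACA.
Qed.

Lemma model_op_bounded :
  exists2 K, 0 <= K & forall f, L2sq (model_op f) <= K * L2sq f.
Proof.
have [Ka Ka0 hKa] := mulop_bounded a; have [Kb Kb0 hKb] := mulop_bounded b.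
have [Kt Kt0 hKt] := mulop_bounded theta; have [Kc Kc0 hKc] := mulop_bounded thetac.
exists (2 * (Ka * (Kt * Kc) + Kb)) => [|f].
  by rewrite mulr_ge0// addr_ge0// !mulr_ge0.
rewrite -mulrA; apply: (le_trans (L2sqD_le _ _)); apply: ler_wpM2l => //.
rewrite mulrDl; apply: lerD.
  apply: (le_trans (hKa _)); rewrite -!mulrA; apply: ler_wpM2l => //.
  apply: (le_trans (hKt _)); apply: ler_wpM2l => //.
  exact: (le_trans (hardy_proj_contraction _)).
apply: (le_trans (hKb _)); apply: ler_wpM2l => //; exact: hardy_proj_contraction.
Qed.

Lemma model_op_commutator (f : L2) : commutator model_op (mulop (z_T R)) f =
  rank_one (mulop a (toL2 theta)) (mulop (zbar_T R) (toL2 theta)) f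
  + rank_one (toL2 b) (toL2 (zbar_T R)) f.
Proof.
rewrite /commutator /model_op theta_proj_z hardy_proj_z !mulopDr !mulopZ.
rewrite (mulopC a (z_T R)) (mulopC b (z_T R)) /rank_one.
by rewrite [X in X - _]addrACA [LHS]addrC addKr.
Qed.

Lemma three_projections (rho : Loo) (f : L2) :
  mulop (rho + a + b) (orthoproj (thetaH2 theta) f)
  + mulop (rho + b) (orthoproj (model_space theta) f)
  + mulop rho (orthoproj (@H2minus R) f) = mulop rho f + model_op f.
Proof.
rewrite orthoproj_thetaH2 orthoproj_model_space orthoproj_H2minus.
rewrite mulopBr !mulopDl mulopBr /model_op.
move: (mulop rho _) (mulop a _) (mulop b _) (mulop rho _) (mulop b _) (mulop rho f).
move=> B D G A E C.
rewrite [A + D + E]addrAC [A + E + D]addrC [X in X + _]addrACA subrr addr0.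
by rewrite [B + G]addrC [D + (G + B)]addrA [C - B]addrC [LHS]addrA addrK addrC.
Qed.

(** Since [model_op_commutator] computes the commutator of the model operator,
    condition (2) says that X - model_op commutes with M_z. *)
Lemma commutator_characterization (X : {linear L2 -> L2}) : bounded_operator X ->
  (exists rho : Loo, forall f, X f = mulop rho f + model_op f) <->
  (forall f, commutator X (mulop (z_T R)) f =
     rank_one (mulop a (toL2 theta)) (mulop (zbar_T R) (toL2 theta)) f
     + rank_one (toL2 b) (toL2 (zbar_T R)) f).
Proof.
move=> /bounded_operator_L2sq[KX KX0 hKX]; split=> [[rho hX] f|hX].
  rewrite -model_op_commutator /commutator !hX mulopDr (mulopC (z_T R)).
  by rewrite opprD addrACA subrr add0r.
have [KA KA0 hKA] := model_op_bounded.
pose Y f := X f - model_op f.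
have Ylin c f g : Y (c *: f + g) = c *: Y f + Y g.
  by rewrite /Y linearP model_op_lin opprD addrACA -scalerBr.
have YK f : L2sq (Y f) <= 2 * (KX + KA) * L2sq f.
  rewrite -mulrA [(KX + KA) * _]mulrDl; apply: (le_trans (L2sqD_le _ _)).
  apply: ler_wpM2l => //; rewrite L2sqN; exact: lerD.
have Yz f : Y (mulop (z_T R) f) = mulop (z_T R) (Y f).
  have := hX f; rewrite -model_op_commutator /commutator /Y mulopBr => /eqP.
  rewrite subr_eq => /eqP ->.
  by rewrite [LHS]addrAC [X in X + _]addrAC subrr add0r addrC.
have K0 : 0 <= 2 * (KX + KA) by rewrite mulr_ge0// addr_ge0.
have [rho hr] := commutant_multiplication Ylin K0 YK Yz.
by exists rho => f; rewrite -hr subrK.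
Qed.

End Symbols.
End InnerFunction.
End Projections.

(** * The characterization *)

Theorem theorem4p2 (R : realType)
    (Theta : R[i] -> R[i]) (theta : LinfT R)
    (htheta : inner_function Theta theta)
    (hnonconst : ~ constant_on_disk Theta)
    (a b : LinfT R)
    (X : {linear L2T R -> L2T R}) (hX : bounded_operator X) :
  ((exists rho : LinfT R, forall f : L2T R,
      X f = mulop (rho + a + b) (orthoproj (thetaH2 theta) f)
            + mulop (rho + b) (orthoproj (model_space theta) f)
            + mulop rho (orthoproj (@H2minus R) f))
   <->
   (forall f : L2T R,
      commutator X (mulop (z_T R)) f
      = rank_one (mulop a (toL2 theta)) (mulop (zbar_T R) (toL2 theta)) f
        + rank_one (toL2 b) (toL2 (zbar_T R)) f))
  /\
  ((exists phi psi chi : LinfT R,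
      [/\ a = phi - psi, b = psi - chi &
          forall f : L2T R,
            X f = mulop phi (orthoproj (thetaH2 theta) f)
                  + mulop psi (orthoproj (model_space theta) f)
                  + mulop chi (orthoproj (@H2minus R) f)])
   <->
   (forall f : L2T R,
      commutator X (mulop (z_T R)) f
      = rank_one (mulop a (toL2 theta)) (mulop (zbar_T R) (toL2 theta)) f
        + rank_one (toL2 b) (toL2 (zbar_T R)) f)).
Proof.
have [analytic bounded bv unimodular] := htheta.
have [thetac thetacE] := Linf_conj theta.
have theta_H2 f : H2 f -> H2 (mulop theta f).
  exact: H2_analytic_multiplier analytic bounded bv.
have decomp := three_projections thetacE unimodular theta_H2 a b.
have char := commutator_characterization thetacE a b hX.
split.
  by split=> [[rho hr]|/char[rho hr]]; [apply/char|];
    exists rho => f; rewrite hr decomp.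
split=> [[phi [psi [chi [aE bE hr]]]]|/char[rho hr]].
  apply/char; exists chi => f; rewrite hr -decomp.
  have -> : chi + b = psi by rewrite bE addrC subrK.
  have -> // : chi + a + b = phi.
  by rewrite addrAC bE [chi + _]addrC subrK aE addrC subrK.
exists (rho + a + b), (rho + b), rho; split.
- by rewrite [rho + a]addrC -[a + rho + b]addrA addrK.
- by rewrite [rho + b]addrC addrK.
- by move=> f; rewrite hr decomp.
Qed.
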